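(* Let $\mathbb{K}$ be a field of characteristic zero. (i) The objects in $\mathbf{Sym}_0(3,2)$ are the invariant forms $B_{3,2}^{A;\gamma}$ given by any $3\times3$ symmetric matrix $A$ and any $0\neq\gamma\in\mathbb{K}$. Moreover, any such $B_{3,2}^{A;\gamma}$ is isomorphic to $B_{3,2}^{\mathbf{0}_{3\times3};1}$ in $\mathbf{Sym}_0(3,2)$. (ii) The objects $B\in\mathbf{Sym}_0(3,3)$ such that the quadratic Lie algebra $\mathbf{Q}_{3,3}(B)$ is indecomposable are the invariant forms $B_{3,3}^{A_1;\gamma;A_2}$ given by any scalar $\gamma\in\mathbb{K}$ and any pair of $3\times3$ symmetric matrices $(A_1,A_2)$ with $\mathrm{rank}\,A_2\geq2$. Moreover, for symmetric matrices $A_1,B_1$, scalars $\delta,\gamma$ and symmetric matrices $A_2,B_2$ of rank $\geq2$, $B_{3,3}^{A_1;\delta;A_2}$ and $B_{3,3}^{B_1;\gamma;B_2}$ are isomorphic in $\mathbf{Sym}_0(3,3)$ if and only if $CB_2C=(\mathrm{Adj}\,P)^tCA_2C(\mathrm{Adj}\,P)$ for some $3\times3$ regular matrix $P$, where $C=\begin{pmatrix} 0 & 0 & 1 \\ 0 & -1 & 0 \\ 1 & 0 & 0 \end{pmatrix}$.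
   Context: For a Lie algebra $\mathfrak{n}$ put $\mathfrak{n}^1=\mathfrak{n}$, $\mathfrak{n}^i=[\mathfrak{n}^{i-1},\mathfrak{n}]$. $\mathfrak{n}_{d,t}=\mathfrak{FL}(d)/\mathfrak{FL}(d)^{t+1}$ is the free $t$-nilpotent Lie algebra over $\mathbb{K}$ on $d$ generators. A bilinear form is invariant if $B([x,y],z)=B(x,[y,z])$. $\mathrm{Ker}(B)=\{x : B(x,y)=0\ \forall y\}$. A quadratic Lie algebra is a Lie algebra with a nondegenerate symmetric invariant bilinear form; it is decomposable if it contains a proper nonzero ideal on which the form is nondegenerate, otherwise indecomposable. $\mathbf{Sym}_0(d,t)$ is the category whose objects are the invariant symmetric bilinear forms $B$ on $\mathfrak{n}_{d,t}$ with $\mathrm{Ker}(B)\subseteq \mathfrak{n}_{d,t}^2$ and $\mathfrak{n}_{d,t}^t\nsubseteq \mathrm{Ker}(B)$. For objects $B_1,B_2$ let $MEnd_\perp(B_1,B_2)$ be the set of Lie algebra endomorphisms $\varphi$ of $\mathfrak{n}_{d,t}$ such that $B_1(x,y)=B_2(\varphi(x),\varphi(y))$ for all $x,y$ and $\varphi(\mathrm{Ker}(B_1))\subseteq \mathrm{Ker}(B_2)$. Then $Hom(B_1,B_2)=MEnd_\perp(B_1,B_2)/\sim$, where $\varphi_1\sim\varphi_2$ iff $(\varphi_1-\varphi_2)(\mathfrak{n}_{d,t})\subseteq \mathrm{Ker}(B_2)$; composition is induced by composition of endomorphisms. For an object $B$, $\mathbf{Q}_{d,t}(B)=(\mathfrak{n}_{d,t}/\mathrm{Ker}(B),\overline{B})$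 with $\overline{B}$ the induced form. Basis of $\mathfrak{n}_{3,2}$: $x_1,x_2,x_3,[x_2,x_1],[x_3,x_1],[x_3,x_2]$. Basis of $\mathfrak{n}_{3,3}$: these six followed by $[[x_2,x_1],x_1]$, $[[x_2,x_1],x_2]$, $[[x_2,x_1],x_3]$, $[[x_3,x_1],x_1]$, $[[x_3,x_1],x_2]$, $[[x_3,x_1],x_3]$, $[[x_3,x_2],x_2]$, $[[x_3,x_2],x_3]$. In these ordered bases, the forms have block matrices $$B_{3,2}^{A;\gamma}:\begin{pmatrix} A & \gamma C \\ \gamma C & 0 \end{pmatrix},\qquad B_{3,3}^{A_1;\gamma;A_2}:\begin{pmatrix} A_1 & \gamma C & A_2' \\ \gamma C & A_2 & 0 \\ (A_2')^t & 0 & 0 \end{pmatrix},$$ where for $A_2=\begin{pmatrix} a & b & c \\ b & d & e \\ c & e & f \end{pmatrix}$, $$A_2'=\begin{pmatrix} 0 & a & b & 0 & b & d & c & e \\ -a & 0 & c & -b & 0 & e & 0 & f \\ -b & -c & 0 & -d & -e & 0 & -f & 0 \end{pmatrix}.$$ $\mathrm{Adj}\,P$ is the cofactor matrix, $\mathrm{Adj}\,P=\det(P)(P^{-1})^t$ for invertible $P$. *)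

(* Defs.v *)
From HB Require Import structures.
From mathcomp Require Import all_boot all_order all_algebra.
From mathcomp Require Import boolp classical_sets.

Set Implicit Arguments.
Unset Strict Implicit.
Unset Printing Implicit Defensive.

Import GRing.Theory.

Local Open Scope ring_scope.
Local Open Scope classical_set_scope.
Local Open Scope quotient_scope.

HB.mixin Record Lmodule_isLieAlgebra (K : fieldType) L of GRing.Lmodule K L := {
  lbr : L -> L -> L;
  lbr_linearl : forall y, linear (lbr^~ y);
  lbr_linearr : forall x, linear (lbr x);
  lbrxx : forall x, lbr x x = 0;
  lbr_jacobi : forall x y z,
    lbr x (lbr y z) + lbr y (lbr z x) + lbr z (lbr x y) = 0
}.

#[short(type="lieAlgType")]
HB.structure Definition LieAlgebra (K : fieldType) :=
  {L of GRing.Lmodule K L & Lmodule_isLieAlgebra K L}.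

Definition lie_morphism (K : fieldType) (L M : lieAlgType K) (f : L -> M) :=
  linear f /\ (forall x y, f (lbr x y) = lbr (f x) (f y)).

Section LieBasics.
Variables (K : fieldType) (L : lieAlgType K).
Implicit Types (x y z u v : L) (a : K) (A B : set L).

Lemma lbrPl a x y z : lbr (a *: x + y) z = a *: lbr x z + lbr y z.
Proof. exact: lbr_linearl. Qed.
Lemma lbrPr a x y z : lbr z (a *: x + y) = a *: lbr z x + lbr z y.
Proof. exact: lbr_linearr. Qed.
Lemma lbrDl x y z : lbr (x + y) z = lbr x z + lbr y z.
Proof. by rewrite -[x in LHS]scale1r lbrPl scale1r. Qed.
Lemma lbrDr x y z : lbr z (x + y) = lbr z x + lbr z y.
Proof. by rewrite -[x in LHS]scale1r lbrPr scale1r. Qed.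
Lemma lbr0l z : lbr 0 z = 0.
Proof. by apply: (addrI (lbr 0 z)); rewrite -lbrDl !addr0. Qed.
Lemma lbr0r z : lbr z 0 = 0.
Proof. by apply: (addrI (lbr z 0)); rewrite -lbrDr !addr0. Qed.
Lemma lbrZl a x z : lbr (a *: x) z = a *: lbr x z.
Proof. by rewrite -[a *: x]addr0 lbrPl lbr0l addr0. Qed.
Lemma lbrZr a x z : lbr z (a *: x) = a *: lbr z x.
Proof. by rewrite -[a *: x]addr0 lbrPr lbr0r addr0. Qed.
Lemma lbrNl x z : lbr (- x) z = - lbr x z.
Proof. by rewrite -scaleN1r lbrZl scaleN1r. Qed.
Lemma lbrNr x z : lbr z (- x) = - lbr z x.
Proof. by rewrite -scaleN1r lbrZr scaleN1r. Qed.
Lemma lbrC x y : lbr x y = - lbr y x.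
Proof.
have := lbrxx (x + y); rewrite lbrDl !lbrDr !lbrxx add0r addr0.
by move=> /eqP; rewrite addr_eq0 => /eqP.
Qed.

Definition is_subspace A := A 0 /\ forall a u v, A u -> A v -> A (a *: u + v).

Definition is_ideal A := is_subspace A /\ forall x y, A x -> A (lbr x y).

Definition lbr_set A B : set L :=
  smallest is_subspace [set lbr x y | x in A & y in B].

(** Indexed from 1, so that [lcs 1 = L] and [lcs i.+1 = [lcs i, L]];
    [lcs 0 = L] is a dummy value. *)
Fixpoint lcs (i : nat) : set L :=
  if i is (j.+1 as k).+1 then lbr_set (lcs k) setT else setT.

Lemma lcsS i : lcs i.+2 = lbr_set (lcs i.+1) setT. Proof. by []. Qed.

Lemma lbr_set_subspace A B : is_subspace (lbr_set A B).
Proof.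
split; first by move=> X [[X0 _] _].
by move=> a u v Au Av X XP; apply: XP.1.2; [apply: Au|apply: Av].
Qed.

Lemma lcs_ideal_subproof i : is_ideal (lcs i).
Proof.
elim: i => [|[|i] IH]; [by split; split | by split; split |].
split; first exact: lbr_set_subspace.
have [[IH0 IHP] IHbr] := IH.
have incl : lcs i.+2 `<=` lcs i.+1.
  rewrite lcsS; apply: smallest_sub => //.
  by move=> _ [x Ax] [y _ <-]; apply: IHbr.
move=> x y /incl Ax; rewrite lcsS; apply: sub_gen_smallest.
by exists x => //; exists y.
Qed.

End LieBasics.

Arguments lcs {K} L i.

Record lie_ideal (K : fieldType) (L : lieAlgType K) := LieIdeal {
  lie_ideal_set :> L -> Prop;
  lie_idealP : is_ideal lie_ideal_set
}.

Definition lcs_ideal (K : fieldType) (L : lieAlgType K) (i : nat) : lie_ideal L :=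
  LieIdeal (lcs_ideal_subproof L i).

Section LieQuotient.
Variables (K : fieldType) (L : lieAlgType K) (I : lie_ideal L).
Implicit Types (x y z : L) (a : K).

Lemma lie_ideal0 : I 0.
Proof. exact: (lie_idealP I).1.1. Qed.
Lemma lie_idealP1 a x y : I x -> I y -> I (a *: x + y).
Proof. exact: (lie_idealP I).1.2. Qed.
Lemma lie_idealD x y : I x -> I y -> I (x + y).
Proof. by move=> Ix Iy; rewrite -[x]scale1r; apply: lie_idealP1. Qed.
Lemma lie_idealZ a x : I x -> I (a *: x).
Proof.
by move=> Ix; rewrite -[_ *: _]addr0; apply: lie_idealP1 => //; apply: lie_ideal0.
Qed.
Lemma lie_idealN x : I x -> I (- x).
Proof. by rewrite -scaleN1r; apply: lie_idealZ. Qed.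
Lemma lie_ideal_brl x y : I x -> I (lbr x y).
Proof. exact: (lie_idealP I).2. Qed.
Lemma lie_ideal_brr x y : I y -> I (lbr x y).
Proof. by move=> Iy; rewrite lbrC; apply/lie_idealN/lie_ideal_brl. Qed.

Definition lie_eqmod (x y : L) : bool := `[< I (x - y) >].

Lemma lie_eqmod_equiv : equiv_class_of lie_eqmod.
Proof.
split=> [x|x y|y x z].
- by apply/asboolP; rewrite subrr; apply: lie_ideal0.
- by apply/asboolP/asboolP => /lie_idealN; rewrite opprB.
- move=> /asboolP xy /asboolP yz; apply/asboolP.
  by rewrite -[x](addrNK y) -addrA; apply: lie_idealD.
Qed.

Canonical lie_eqmod_rel := EquivRelPack lie_eqmod_equiv.
Canonical lie_eqmod_enc := defaultEncModRel lie_eqmod.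

Definition lie_quot := {eq_quot lie_eqmod}.

HB.instance Definition _ : EqQuotient L lie_eqmod lie_quot :=
  EqQuotient.on lie_quot.
HB.instance Definition _ := Choice.on lie_quot.

Definition lie_proj (x : L) : lie_quot := \pi_lie_quot x.

Lemma lie_projP x y : lie_proj x = lie_proj y <-> I (x - y).
Proof.
rewrite /lie_proj; split; first by move=> /eqmodP/asboolP.
by move=> Ixy; apply/eqmodP/asboolP.
Qed.

Lemma lie_reprK : cancel (repr : lie_quot -> L) lie_proj.
Proof. exact: reprK. Qed.

Lemma lie_repr_proj x : I (repr (lie_proj x) - x).
Proof. by apply/lie_projP; rewrite lie_reprK. Qed.

Definition lie_quot_zero : lie_quot := lie_proj 0.
Definition lie_quot_opp (u : lie_quot) : lie_quot := lie_proj (- repr u).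
Definition lie_quot_add (u v : lie_quot) : lie_quot :=
  lie_proj (repr u + repr v).
Definition lie_quot_scale a (u : lie_quot) : lie_quot := lie_proj (a *: repr u).
Definition lie_quot_br (u v : lie_quot) : lie_quot :=
  lie_proj (lbr (repr u) (repr v)).

Lemma lie_quot_addE x y :
  lie_quot_add (lie_proj x) (lie_proj y) = lie_proj (x + y).
Proof.
apply/lie_projP; rewrite opprD addrACA.
by apply: lie_idealD; apply: lie_repr_proj.
Qed.
Lemma lie_quot_oppE x : lie_quot_opp (lie_proj x) = lie_proj (- x).
Proof.
by apply/lie_projP; rewrite -opprD; apply/lie_idealN/lie_repr_proj.
Qed.
Lemma lie_quot_scaleE a x : lie_quot_scale a (lie_proj x) = lie_proj (a *: x).
Proof.
by apply/lie_projP; rewrite -scalerBr; apply/lie_idealZ/lie_repr_proj.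
Qed.
Lemma lie_quot_brE x y :
  lie_quot_br (lie_proj x) (lie_proj y) = lie_proj (lbr x y).
Proof.
apply/lie_projP; set x' := repr _; set y' := repr _.
have -> : lbr x' y' - lbr x y = lbr (x' - x) y' + lbr x (y' - y).
  by rewrite lbrDl lbrNl lbrDr lbrNr addrA addrNK.
by apply: lie_idealD; [apply: lie_ideal_brl|apply: lie_ideal_brr];
  apply: lie_repr_proj.
Qed.

Let lieE := (lie_quot_addE, lie_quot_oppE, lie_quot_scaleE, lie_quot_brE).

Lemma lie_quot_addA : associative lie_quot_add.
Proof.
by move=> u v w; rewrite -(lie_reprK u) -(lie_reprK v) -(lie_reprK w) !lieE addrA.
Qed.
Lemma lie_quot_addC : commutative lie_quot_add.
Proof. by move=> u v; rewrite /lie_quot_add addrC. Qed.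
Lemma lie_quot_add0 : left_id lie_quot_zero lie_quot_add.
Proof. by move=> u; rewrite -(lie_reprK u) lieE add0r. Qed.
Lemma lie_quot_addN : left_inverse lie_quot_zero lie_quot_opp lie_quot_add.
Proof. by move=> u; rewrite -(lie_reprK u) !lieE addNr. Qed.

HB.instance Definition _ := GRing.isZmodule.Build lie_quot
  lie_quot_addA lie_quot_addC lie_quot_add0 lie_quot_addN.

Lemma lie_quot_scaleA a b u :
  lie_quot_scale a (lie_quot_scale b u) = lie_quot_scale (a * b) u.
Proof. by rewrite -(lie_reprK u) !lieE scalerA. Qed.
Lemma lie_quot_scale1 : left_id 1 lie_quot_scale.
Proof. by move=> u; rewrite -(lie_reprK u) lieE scale1r. Qed.
Lemma lie_quot_scaleDr : right_distributive lie_quot_scale +%R.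
Proof.
move=> a u v; rewrite -(lie_reprK u) -(lie_reprK v).
by rewrite /GRing.add /= !lieE scalerDr.
Qed.
Lemma lie_quot_scaleDl u :
  {morph lie_quot_scale^~ u : a b / a + b >-> a + b}.
Proof.
move=> a b /=; rewrite -(lie_reprK u).
by rewrite [in RHS]/GRing.add /= !lieE scalerDl.
Qed.

HB.instance Definition _ := GRing.Zmodule_isLmodule.Build K lie_quot
  lie_quot_scaleA lie_quot_scale1 lie_quot_scaleDr lie_quot_scaleDl.

Lemma lie_projD x y : lie_proj (x + y) = lie_proj x + lie_proj y.
Proof. by rewrite -lie_quot_addE. Qed.
Lemma lie_projZ a x : lie_proj (a *: x) = a *: lie_proj x.
Proof. by rewrite -lie_quot_scaleE. Qed.
Lemma lie_proj0 : lie_proj 0 = 0. Proof. by []. Qed.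

Lemma lie_quot_br_linearl v : linear (lie_quot_br^~ v).
Proof.
move=> a u1 u2; rewrite -(lie_reprK u1) -(lie_reprK u2) -(lie_reprK v).
by rewrite -lie_projZ -lie_projD !lie_quot_brE lbrPl lie_projD lie_projZ.
Qed.
Lemma lie_quot_br_linearr u : linear (lie_quot_br u).
Proof.
move=> a v1 v2; rewrite -(lie_reprK v1) -(lie_reprK v2) -(lie_reprK u).
by rewrite -lie_projZ -lie_projD !lie_quot_brE lbrPr lie_projD lie_projZ.
Qed.
Lemma lie_quot_brxx u : lie_quot_br u u = 0.
Proof. by rewrite /lie_quot_br lbrxx. Qed.
Lemma lie_quot_jacobi u v w :
  lie_quot_br u (lie_quot_br v w) + lie_quot_br v (lie_quot_br w u)
  + lie_quot_br w (lie_quot_br u v) = 0.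
Proof.
rewrite -(lie_reprK u) -(lie_reprK v) -(lie_reprK w) !lie_quot_brE.
by rewrite -!lie_projD lbr_jacobi.
Qed.

HB.instance Definition _ := Lmodule_isLieAlgebra.Build K lie_quot
  lie_quot_br_linearl lie_quot_br_linearr lie_quot_brxx lie_quot_jacobi.

Lemma lie_proj_morphism : lie_morphism lie_proj.
Proof.
split=> [a x y|x y]; first by rewrite lie_projD lie_projZ.
by symmetry; apply: lie_quot_brE.
Qed.

End LieQuotient.

Inductive lie_term (K : Type) (d : nat) : Type :=
| LGen of 'I_d
| LZero
| LAdd of lie_term K d & lie_term K d
| LScale of K & lie_term K d
| LBr of lie_term K d & lie_term K d.

Arguments LGen {K d}.
Arguments LZero {K d}.

HB.instance Definition _ (K : Type) d := gen_eqMixin (lie_term K d).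
HB.instance Definition _ (K : Type) d := gen_choiceMixin (lie_term K d).

(** The least congruence on terms that contains the Lie algebra axioms. *)
Inductive lie_cong (K : fieldType) (d : nat) :
    lie_term K d -> lie_term K d -> Prop :=
| lc_refl u : lie_cong u u
| lc_sym u v : lie_cong u v -> lie_cong v u
| lc_trans v u w : lie_cong u v -> lie_cong v w -> lie_cong u w
| lc_add u u' v v' :
    lie_cong u u' -> lie_cong v v' -> lie_cong (LAdd u v) (LAdd u' v')
| lc_scale a u u' : lie_cong u u' -> lie_cong (LScale a u) (LScale a u')
| lc_br u u' v v' :
    lie_cong u u' -> lie_cong v v' -> lie_cong (LBr u v) (LBr u' v')
| lc_addA u v w : lie_cong (LAdd u (LAdd v w)) (LAdd (LAdd u v) w)
| lc_addC u v : lie_cong (LAdd u v) (LAdd v u)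
| lc_add0 u : lie_cong (LAdd LZero u) u
| lc_addN u : lie_cong (LAdd (LScale (-1) u) u) LZero
| lc_scaleA a b u : lie_cong (LScale a (LScale b u)) (LScale (a * b) u)
| lc_scale1 u : lie_cong (LScale 1 u) u
| lc_scaleDr a u v :
    lie_cong (LScale a (LAdd u v)) (LAdd (LScale a u) (LScale a v))
| lc_scaleDl a b u :
    lie_cong (LScale (a + b) u) (LAdd (LScale a u) (LScale b u))
| lc_brPl a u v w :
    lie_cong (LBr (LAdd (LScale a u) v) w) (LAdd (LScale a (LBr u w)) (LBr v w))
| lc_brPr a u v w :
    lie_cong (LBr w (LAdd (LScale a u) v)) (LAdd (LScale a (LBr w u)) (LBr w v))
| lc_brxx u : lie_cong (LBr u u) LZero
| lc_jacobi u v w :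
    lie_cong
      (LAdd (LAdd (LBr u (LBr v w)) (LBr v (LBr w u))) (LBr w (LBr u v)))
      LZero.

Section FreeLie.
Variables (K : fieldType) (d : nat).
Implicit Types (u v w : lie_term K d) (a b : K).

Definition lie_congb u v : bool := `[< lie_cong u v >].

Lemma lie_congb_equiv : equiv_class_of lie_congb.
Proof.
split=> [u|u v|v u w]; first exact/asboolP/lc_refl.
  by apply/asboolP/asboolP; apply: lc_sym.
by move=> /asboolP uv /asboolP vw; apply/asboolP/(lc_trans uv).
Qed.

Canonical lie_congb_rel := EquivRelPack lie_congb_equiv.
Canonical lie_congb_enc := defaultEncModRel lie_congb.

Definition free_lie := {eq_quot lie_congb}.

HB.instance Definition _ : EqQuotient (lie_term K d) lie_congb free_lie :=
  EqQuotient.on free_lie.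
HB.instance Definition _ := Choice.on free_lie.

Definition free_class u : free_lie := \pi_free_lie u.

Lemma free_classP u v : free_class u = free_class v <-> lie_cong u v.
Proof.
rewrite /free_class; split; first by move=> /eqmodP/asboolP.
by move=> uv; apply/eqmodP/asboolP.
Qed.

Lemma free_reprK : cancel (repr : free_lie -> lie_term K d) free_class.
Proof. exact: reprK. Qed.

Lemma free_repr_class u : lie_cong (repr (free_class u)) u.
Proof. by apply/free_classP; rewrite free_reprK. Qed.

Definition free_zero : free_lie := free_class LZero.
Definition free_add (x y : free_lie) : free_lie :=
  free_class (LAdd (repr x) (repr y)).
Definition free_scale a (x : free_lie) : free_lie :=
  free_class (LScale a (repr x)).
Definition free_opp (x : free_lie) : free_lie := free_scale (-1) x.
Definition free_br (x y : free_lie) : free_lie :=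
  free_class (LBr (repr x) (repr y)).

Lemma free_addE u v :
  free_add (free_class u) (free_class v) = free_class (LAdd u v).
Proof. by apply/free_classP/lc_add; apply: free_repr_class. Qed.
Lemma free_scaleE a u : free_scale a (free_class u) = free_class (LScale a u).
Proof. by apply/free_classP/lc_scale; apply: free_repr_class. Qed.
Lemma free_brE u v :
  free_br (free_class u) (free_class v) = free_class (LBr u v).
Proof. by apply/free_classP/lc_br; apply: free_repr_class. Qed.

Let freeE := (free_addE, free_scaleE, free_brE).

Lemma free_addA : associative free_add.
Proof.
move=> x y z; rewrite -(free_reprK x) -(free_reprK y) -(free_reprK z) !freeE.
exact/free_classP/lc_addA.
Qed.
Lemma free_addC : commutative free_add.
Proof. by move=> x y; apply/free_classP/lc_addC. Qed.
Lemma free_add0 : left_id free_zero free_add.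
Proof.
by move=> x; rewrite -(free_reprK x) freeE; apply/free_classP/lc_add0.
Qed.
Lemma free_addN : left_inverse free_zero free_opp free_add.
Proof.
by move=> x; rewrite -(free_reprK x) /free_opp !freeE; apply/free_classP/lc_addN.
Qed.

HB.instance Definition _ := GRing.isZmodule.Build free_lie
  free_addA free_addC free_add0 free_addN.

Lemma free_scaleA a b x : free_scale a (free_scale b x) = free_scale (a * b) x.
Proof. by rewrite -(free_reprK x) !freeE; apply/free_classP/lc_scaleA. Qed.
Lemma free_scale1 : left_id 1 free_scale.
Proof.
by move=> x; rewrite -(free_reprK x) !freeE; apply/free_classP/lc_scale1.
Qed.
Lemma free_scaleDr : right_distributive free_scale +%R.
Proof.
move=> a x y; rewrite -(free_reprK x) -(free_reprK y) /GRing.add /= !freeE.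
exact/free_classP/lc_scaleDr.
Qed.
Lemma free_scaleDl x : {morph free_scale^~ x : a b / a + b >-> a + b}.
Proof.
move=> a b /=; rewrite -(free_reprK x) [in RHS]/GRing.add /= !freeE.
exact/free_classP/lc_scaleDl.
Qed.

HB.instance Definition _ := GRing.Zmodule_isLmodule.Build K free_lie
  free_scaleA free_scale1 free_scaleDr free_scaleDl.

Lemma free_classD u v : free_class (LAdd u v) = free_class u + free_class v.
Proof. by rewrite -free_addE. Qed.
Lemma free_classZ a u : free_class (LScale a u) = a *: free_class u.
Proof. by rewrite -free_scaleE. Qed.
Lemma free_class0 : free_class LZero = 0. Proof. by []. Qed.

Lemma free_br_linearl y : linear (free_br^~ y).
Proof.
move=> a x1 x2; rewrite -(free_reprK x1) -(free_reprK x2) -(free_reprK y).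
rewrite -free_classZ -free_classD !free_brE -free_classZ -free_classD.
exact/free_classP/lc_brPl.
Qed.
Lemma free_br_linearr x : linear (free_br x).
Proof.
move=> a y1 y2; rewrite -(free_reprK y1) -(free_reprK y2) -(free_reprK x).
rewrite -free_classZ -free_classD !free_brE -free_classZ -free_classD.
exact/free_classP/lc_brPr.
Qed.
Lemma free_brxx x : free_br x x = 0.
Proof. exact/free_classP/lc_brxx. Qed.
Lemma free_jacobi x y z :
  free_br x (free_br y z) + free_br y (free_br z x)
  + free_br z (free_br x y) = 0.
Proof.
rewrite -(free_reprK x) -(free_reprK y) -(free_reprK z) !free_brE.
by rewrite -!free_classD; apply/free_classP/lc_jacobi.
Qed.

HB.instance Definition _ := Lmodule_isLieAlgebra.Build K free_lie
  free_br_linearl free_br_linearr free_brxx free_jacobi.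

Lemma free_class_br u v :
  free_class (LBr u v) = lbr (free_class u) (free_class v).
Proof. by symmetry; apply: free_brE. Qed.

Definition free_gen (i : 'I_d) : free_lie := free_class (LGen i).

Section Lift.
Variables (M : lieAlgType K) (g : 'I_d -> M).

Fixpoint term_eval u : M :=
  match u with
  | LGen i => g i
  | LZero => 0
  | LAdd u v => term_eval u + term_eval v
  | LScale a u => a *: term_eval u
  | LBr u v => lbr (term_eval u) (term_eval v)
  end.

Lemma term_eval_cong u v : lie_cong u v -> term_eval u = term_eval v.
Proof.
elim=> //=; clear.
- by move=> v u w _ -> _ ->.
- by move=> u u' v v' _ -> _ ->.
- by move=> a u u' _ ->.
- by move=> u u' v v' _ -> _ ->.
- by move=> *; rewrite addrA.
- by move=> *; rewrite addrC.
- by move=> *; rewrite add0r.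
- by move=> *; rewrite scaleN1r addNr.
- by move=> *; rewrite scalerA.
- by move=> *; rewrite scale1r.
- by move=> *; rewrite scalerDr.
- by move=> *; rewrite scalerDl.
- by move=> *; rewrite lbrPl.
- by move=> *; rewrite lbrPr.
- by move=> *; rewrite lbrxx.
- by move=> *; rewrite lbr_jacobi.
Qed.

Definition free_lift (x : free_lie) : M := term_eval (repr x).

Lemma free_lift_class u : free_lift (free_class u) = term_eval u.
Proof. exact/term_eval_cong/free_repr_class. Qed.

Lemma free_lift_gen i : free_lift (free_gen i) = g i.
Proof. exact: free_lift_class. Qed.

Lemma free_lift_morphism : lie_morphism free_lift.
Proof.
split=> [a x y|x y]; rewrite -(free_reprK x) -(free_reprK y).
  by rewrite -free_classZ -free_classD !free_lift_class.
by rewrite -free_class_br !free_lift_class.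
Qed.

Lemma free_lift_unique (f : free_lie -> M) :
  lie_morphism f -> (forall i, f (free_gen i) = g i) -> f =1 free_lift.
Proof.
move=> [flin fbr] fg x; rewrite -(free_reprK x) free_lift_class.
have f0 : f 0 = 0.
  apply: (addrI (f 0)); rewrite addr0.
  by have := flin 1 0 0; rewrite !scale1r addr0.
elim: (repr x) => [i| |u IHu v IHv|a u IHu|u IHu v IHv] /=.
- exact: fg.
- by rewrite free_class0.
- by rewrite free_classD -[free_class u]scale1r flin scale1r IHu IHv.
- by rewrite free_classZ -[a *: _]addr0 flin f0 addr0 IHu.
- by rewrite free_class_br fbr IHu IHv.
Qed.

End Lift.
End FreeLie.

Definition free_nilp (K : fieldType) (d t : nat) : lieAlgType K :=
  lie_quot (lcs_ideal (free_lie K d) t.+1).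

Definition nilp_gen (K : fieldType) (d t : nat) (i : 'I_d) : free_nilp K d t :=
  lie_proj (lcs_ideal (free_lie K d) t.+1) (free_gen K i).

Section Forms.
Variables (K : fieldType) (L : lieAlgType K).
Implicit Types (B : L -> L -> K) (I : set L).

Definition is_bilinear B := (forall y, scalar (B^~ y)) /\ (forall x, scalar (B x)).

Definition is_symmetric B := forall x y, B x y = B y x.

Definition is_invariant B := forall x y z, B (lbr x y) z = B x (lbr y z).

Definition form_ker B : set L := [set x | forall y, B x y = 0].

Definition nondegenerate_on B I :=
  forall x, I x -> (forall y, I y -> B x y = 0) -> x = 0.

End Forms.

Record quadLie (K : fieldType) := QuadLie {
  quad_lie :> lieAlgType K;
  quad_form : quad_lie -> quad_lie -> K;
  quad_bilinear : is_bilinear quad_form;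
  quad_symmetric : is_symmetric quad_form;
  quad_invariant : is_invariant quad_form;
  quad_nondeg : form_ker quad_form = [set 0]
}.

Definition decomposable (K : fieldType) (Q : quadLie K) :=
  exists I : set Q, [/\ is_ideal I, I <> [set 0], I <> setT &
                        nondegenerate_on (@quad_form K Q) I].

Definition indecomposable (K : fieldType) (Q : quadLie K) := ~ decomposable Q.

Definition is_sym0 (K : fieldType) (d t : nat)
    (B : free_nilp K d t -> free_nilp K d t -> K) :=
  [/\ is_bilinear B, is_symmetric B, is_invariant B,
      form_ker B `<=` lcs (free_nilp K d t) 2 &
      ~ (lcs (free_nilp K d t) t `<=` form_ker B)].

Record sym0 (K : fieldType) (d t : nat) := Sym0 {
  sym0_form :> free_nilp K d t -> free_nilp K d t -> K;
  sym0P : is_sym0 sym0_form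
}.

Section FormTheory.
Variables (K : fieldType) (d t : nat) (B : sym0 K d t).
Implicit Types (x y z : free_nilp K d t) (a : K).

Lemma sym0_sym : is_symmetric B. Proof. by case: (sym0P B). Qed.
Lemma sym0_inv : is_invariant B. Proof. by case: (sym0P B). Qed.
Lemma sym0_Pl a x y z : B (a *: x + y) z = a * B x z + B y z.
Proof. by case: (sym0P B) => -[+ _] _ _ _ _; apply. Qed.
Lemma sym0_Pr a x y z : B z (a *: x + y) = a * B z x + B z y.
Proof. by case: (sym0P B) => -[_ +] _ _ _ _; apply. Qed.
Lemma sym0_Dl x y z : B (x + y) z = B x z + B y z.
Proof. by rewrite -[x in LHS]scale1r sym0_Pl mul1r. Qed.
Lemma sym0_0l z : B 0 z = 0.
Proof. by apply: (addrI (B 0 z)); rewrite -sym0_Dl !addr0. Qed.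

Lemma form_ker_ideal_subproof : is_ideal (form_ker B).
Proof.
split; first split=> [y|a u v ku kv y]; rewrite ?sym0_0l //.
  by rewrite sym0_Pl ku kv mulr0 addr0.
by move=> x y kx z; rewrite sym0_inv kx.
Qed.

Definition form_ker_ideal : lie_ideal (free_nilp K d t) :=
  LieIdeal form_ker_ideal_subproof.

Definition form_quot := lie_quot form_ker_ideal.

Definition form_quot_form (u v : form_quot) : K := B (repr u) (repr v).

Lemma form_repr_proj x y : B (repr (lie_proj form_ker_ideal x)) y = B x y.
Proof.
rewrite -[repr _](subrK x) sym0_Dl.
by rewrite (lie_repr_proj form_ker_ideal x) add0r.
Qed.

Lemma form_quot_formE x y :
  form_quot_form (lie_proj form_ker_ideal x) (lie_proj form_ker_ideal y) = B x y.
Proof. by rewrite /form_quot_form form_repr_proj sym0_sym form_repr_proj sym0_sym. Qed.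

Lemma form_quot_symmetric : is_symmetric form_quot_form.
Proof. by move=> u v; apply: sym0_sym. Qed.

Lemma form_quot_bilinear : is_bilinear form_quot_form.
Proof.
suff lin v : scalar (form_quot_form^~ v).
  split=> // u a v w; rewrite !(form_quot_symmetric u); exact: lin.
move=> a u w; rewrite -(lie_reprK u) -(lie_reprK v) -(lie_reprK w).
by rewrite -lie_projZ -lie_projD !form_quot_formE sym0_Pl.
Qed.

Lemma form_quot_invariant : is_invariant form_quot_form.
Proof.
move=> u v w; rewrite -(lie_reprK u) -(lie_reprK v) -(lie_reprK w).
by rewrite -!(lie_proj_morphism _).2 !form_quot_formE sym0_inv.
Qed.

Lemma form_quot_nondeg : form_ker form_quot_form = [set 0].
Proof.
apply/seteqP; split=> [u uK|_ -> v]; last first.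
  by rewrite -(lie_reprK v) -lie_proj0 form_quot_formE sym0_0l.
rewrite /set1 /= -(lie_reprK u) -lie_proj0; apply/lie_projP; rewrite subr0 => y.
by have := uK (lie_proj form_ker_ideal y); rewrite -{1}(lie_reprK u) form_quot_formE.
Qed.

Definition sym0_quad : quadLie K :=
  @QuadLie K form_quot form_quot_form form_quot_bilinear
    form_quot_symmetric form_quot_invariant form_quot_nondeg.

End FormTheory.

Definition is_mend (K : fieldType) (d t : nat) (B1 B2 : sym0 K d t)
    (f : free_nilp K d t -> free_nilp K d t) :=
  [/\ lie_morphism f, (forall x y, B1 x y = B2 (f x) (f y)) &
      f @` form_ker B1 `<=` form_ker B2].

Record mend (K : fieldType) (d t : nat) (B1 B2 : sym0 K d t) := Mend {
  mend_fun :> free_nilp K d t -> free_nilp K d t;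
  mendP : is_mend B1 B2 mend_fun
}.

HB.instance Definition _ (K : fieldType) d t (B1 B2 : sym0 K d t) :=
  gen_eqMixin (mend B1 B2).
HB.instance Definition _ (K : fieldType) d t (B1 B2 : sym0 K d t) :=
  gen_choiceMixin (mend B1 B2).

Section MEnd.
Variables (K : fieldType) (d t : nat).
Implicit Types B : sym0 K d t.

Lemma mend_id_subproof B : is_mend B B id.
Proof. by split=> // _ [x kx <-]. Qed.

Definition mend_id B : mend B B := Mend (mend_id_subproof B).

Lemma mend_comp_subproof B1 B2 B3 (f : mend B2 B3) (g : mend B1 B2) :
  is_mend B1 B3 (f \o g).
Proof.
have [[flin fbr] fB fK] := mendP f; have [[glin gbr] gB gK] := mendP g.
split=> [|x y|_ [x kx <-]] /=; [split=> [a x y|x y] /= | |].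
- by rewrite glin flin.
- by rewrite gbr fbr.
- by rewrite gB fB.
- by apply: fK; exists (g x) => //; apply: gK; exists x.
Qed.

Definition mend_comp B1 B2 B3 (f : mend B2 B3) (g : mend B1 B2) : mend B1 B3 :=
  Mend (mend_comp_subproof f g).

Section Hom.
Variables B1 B2 : sym0 K d t.

Definition mend_eqb (f g : mend B1 B2) : bool :=
  `[< forall x, form_ker B2 (f x - g x) >].

Lemma mend_eqb_equiv : equiv_class_of mend_eqb.
Proof.
split=> [f|f g|g f h].
- by apply/asboolP => x; rewrite subrr; apply: (lie_ideal0 (form_ker_ideal B2)).
- by apply/asboolP/asboolP => fg x; rewrite -opprB;
    apply: (lie_idealN (I := form_ker_ideal B2)); apply: fg.
- move=> /asboolP fg /asboolP gh; apply/asboolP => x.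
  rewrite -[f x](addrNK (g x)) -addrA.
  by apply: (lie_idealD (I := form_ker_ideal B2)); [apply: fg|apply: gh].
Qed.

Canonical mend_eqb_rel := EquivRelPack mend_eqb_equiv.
Canonical mend_eqb_enc := defaultEncModRel mend_eqb.

Definition hom := {eq_quot mend_eqb}.

HB.instance Definition _ : EqQuotient (mend B1 B2) mend_eqb hom :=
  EqQuotient.on hom.
HB.instance Definition _ := Choice.on hom.

Definition hom_class (f : mend B1 B2) : hom := \pi_hom f.

Lemma hom_classP f g :
  hom_class f = hom_class g <-> forall x, form_ker B2 (f x - g x).
Proof.
rewrite /hom_class; split; first by move=> /eqmodP/asboolP.
by move=> fg; apply/eqmodP/asboolP.
Qed.

Lemma hom_reprK : cancel (repr : hom -> mend B1 B2) hom_class.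
Proof. exact: reprK. Qed.

End Hom.

Definition hom_id B : hom B B := hom_class (mend_id B).

Definition hom_comp B1 B2 B3 (F : hom B2 B3) (G : hom B1 B2) : hom B1 B3 :=
  hom_class (mend_comp (repr F) (repr G)).

Lemma hom_compE B1 B2 B3 (f : mend B2 B3) (g : mend B1 B2) :
  hom_comp (hom_class f) (hom_class g) = hom_class (mend_comp f g).
Proof.
apply/hom_classP => x /=.
have [[flin _] _ fK] := mendP f.
set f' := repr _; set g' := repr _.
have ff' y : form_ker B3 (f' y - f y).
  by move: y; apply/hom_classP; rewrite hom_reprK.
have gg' y : form_ker B2 (g' y - g y).
  by move: y; apply/hom_classP; rewrite hom_reprK.
have -> : f' (g' x) - f (g x) = (f' (g' x) - f (g' x)) + f (g' x - g x).
  have -> : f (g' x - g x) = f (g' x) - f (g x).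
    by rewrite addrC -scaleN1r flin scaleN1r addrC.
  by rewrite addrA subrK.
apply: (lie_idealD (I := form_ker_ideal B3)); first exact: ff'.
by apply: fK; exists (g' x - g x).
Qed.

Lemma hom_compA B1 B2 B3 B4 (F : hom B3 B4) (G : hom B2 B3) (H : hom B1 B2) :
  hom_comp F (hom_comp G H) = hom_comp (hom_comp F G) H.
Proof.
rewrite -(hom_reprK F) -(hom_reprK G) -(hom_reprK H) !hom_compE.
apply/hom_classP => x /=; rewrite subrr.
exact: (lie_ideal0 (form_ker_ideal B4)).
Qed.

Lemma hom_comp1l B1 B2 (F : hom B1 B2) : hom_comp (hom_id B2) F = F.
Proof.
rewrite -(hom_reprK F) /hom_id hom_compE; apply/hom_classP => x /=.
by rewrite subrr; apply: (lie_ideal0 (form_ker_ideal B2)).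
Qed.

Lemma hom_comp1r B1 B2 (F : hom B1 B2) : hom_comp F (hom_id B1) = F.
Proof.
rewrite -(hom_reprK F) /hom_id hom_compE; apply/hom_classP => x /=.
by rewrite subrr; apply: (lie_ideal0 (form_ker_ideal B2)).
Qed.

Definition isomorphic B1 B2 :=
  exists (F : hom B1 B2) (G : hom B2 B1),
    hom_comp G F = hom_id B1 /\ hom_comp F G = hom_id B2.

End MEnd.

Section GramForm.
Variables (K : fieldType) (L : lieAlgType K) (n : nat).

(** The coordinates of [v] in [e], for [e] a basis of [L]; on a vector outside
    the span of [e] the value would be [0]. *)
Definition coords (e : n.-tuple L) (v : L) : 'rV[K]_n :=
  xget 0 [set c : 'rV[K]_n | v = \sum_(i < n) c 0 i *: tnth e i].

Definition gram_form (e : n.-tuple L) (M : 'M[K]_n) (u v : L) : K :=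
  (coords e u *m M *m (coords e v)^T) 0 0.

End GramForm.

Definition mx_of_rows (K : fieldType) (m n : nat) (rows : seq (seq K)) : 'M[K]_(m, n) :=
  \matrix_(i < m, j < n) nth 0 (nth [::] rows i) j.

Section Rank3.
Variable K : fieldType.

Definition basis32 : 6.-tuple (free_nilp K 3 2) :=
  let x1 := nilp_gen K 2 (0 : 'I_3) in
  let x2 := nilp_gen K 2 (1 : 'I_3) in
  let x3 := nilp_gen K 2 (2 : 'I_3) in
  [tuple x1; x2; x3; lbr x2 x1; lbr x3 x1; lbr x3 x2].

Definition basis33 : 14.-tuple (free_nilp K 3 3) :=
  let x1 := nilp_gen K 3 (0 : 'I_3) in
  let x2 := nilp_gen K 3 (1 : 'I_3) in
  let x3 := nilp_gen K 3 (2 : 'I_3) in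
  [tuple x1; x2; x3; lbr x2 x1; lbr x3 x1; lbr x3 x2;
    lbr (lbr x2 x1) x1; lbr (lbr x2 x1) x2; lbr (lbr x2 x1) x3;
    lbr (lbr x3 x1) x1; lbr (lbr x3 x1) x2; lbr (lbr x3 x1) x3;
    lbr (lbr x3 x2) x2; lbr (lbr x3 x2) x3].

Definition Cmx : 'M[K]_3 :=
  mx_of_rows 3 3 [:: [:: 0;  0; 1];
                     [:: 0; -1; 0];
                     [:: 1;  0; 0]].

(** Only the upper triangle of [A2], meant to be symmetric, is read. *)
Definition primemx (A2 : 'M[K]_3) : 'M[K]_(3, 8) :=
  let a := A2 0 0 in let b := A2 0 1 in let c := A2 0 2 in
  let d := A2 1 1 in let e := A2 1 2 in let f := A2 2 2 in
  mx_of_rows 3 8 [:: [::   0;   a; b;   0;   b; d;   c; e];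
                     [:: - a;   0; c; - b;   0; e;   0; f];
                     [:: - b; - c; 0; - d; - e; 0; - f; 0]].

Definition mx32 (A : 'M[K]_3) (gam : K) : 'M[K]_(3 + 3) :=
  block_mx A             (gam *: Cmx)
           (gam *: Cmx)  0.

Definition mx33 (A1 : 'M[K]_3) (gam : K) (A2 : 'M[K]_3) : 'M[K]_(3 + (3 + 8)) :=
  block_mx A1                                  (row_mx (gam *: Cmx) (primemx A2))
           (col_mx (gam *: Cmx) (primemx A2)^T) (block_mx A2 0 0 0).

Definition form32 (A : 'M[K]_3) (gam : K) :
    free_nilp K 3 2 -> free_nilp K 3 2 -> K :=
  gram_form basis32 (mx32 A gam).

Definition form33 (A1 : 'M[K]_3) (gam : K) (A2 : 'M[K]_3) :
    free_nilp K 3 3 -> free_nilp K 3 3 -> K :=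
  gram_form basis33 (mx33 A1 gam A2).

(** The cofactor matrix, i.e. the transpose of MathComp's [\adj P]. *)
Definition cofactor_mx (P : 'M[K]_3) : 'M[K]_3 := \matrix_(i, j) cofactor P i j.

End Rank3.

Arguments Cmx {K}.

(* Main.v *)
(** With generators [X_i], put [Y_i = [X_(i+1), X_(i+2)]] (indices modulo 3). In
    class at most three every element is a combination of the [X_i], the [Y_i]
    and the [[Y_i, X_j]], with coordinates a vector [x], a vector [u] and a
    matrix [M] modulo scalars (the Jacobi identity says that the trace of
    [[Y_i, X_j]] vanishes), and the bracket of [(x, u, M)] and [(y, v, N)] is
    [(0, x * y, u^T y - v^T x)] with [*] the cross product. Invariance then forces
    a symmetric form to be given by the matrices [A] of the [B(X_i, X_j)] and
    [S] of the [B(Y_i, Y_j)] and the scalar [g = B(X_0, Y_0)]; the pairing of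
    [x] with [M] is [tau S x M], which is nondegenerate in [x] if and only if
    [S] has rank at least 2.

    An endomorphism with [X_i |-> (R_i, T_i, M_i)] replaces [S] by
    [cof R S (cof R)^T]; if [S] has rank at least 2, then [T] and [M] can be
    chosen to reach any value of [g] and [A], so [S] is the only invariant.

    If the quotient splits, lift the two summands to [E] and [F]. The cross
    products of their linear parts lie in the kernel of [S], of dimension at most
    1, which forces one of [E], [F] into the derived algebra and then into the
    kernel of the form. If [S] has rank 1, there is an element orthogonal to the
    derived algebra but outside it, and it spans an orthogonal summand. *)
Require Import Defs.
From HB Require Import structures.
From mathcomp Require Import all_boot all_order all_algebra.
From mathcomp Require Import boolp classical_sets.
From mathcomp Require Import ring.

Set Implicit Arguments.
Unset Strict Implicit.
Unset Printing Implicit Defensive.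

Import GRing.Theory.

Local Open Scope ring_scope.

(** * Vectors of length three *)

Lemma ord3_ind (P : 'I_3 -> Prop) : P 0 -> P 1 -> P 2 -> forall i, P i.
Proof.
move=> P0 P1 P2 [[|[|[|//]]] h].
- by have -> : Ordinal h = 0 by apply: val_inj.
- by have -> : Ordinal h = 1 by apply: val_inj.
- by have -> : Ordinal h = 2 by apply: val_inj.
Qed.

Lemma ord3_addE :
  ((0 + 1 = 1 :> 'I_3)%R * (1 + 1 = 2 :> 'I_3)%R * (2 + 1 = 0 :> 'I_3)%R *
   (0 + 2 = 2 :> 'I_3)%R * (1 + 2 = 0 :> 'I_3)%R * (2 + 2 = 1 :> 'I_3)%R)%type.
Proof. by do !split; apply: val_inj. Qed.

Lemma ord3_val :
  ((nat_of_ord (0%R : 'I_3) = 0%N) * (nat_of_ord (1%R : 'I_3) = 1%N) *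
   (nat_of_ord (2%R : 'I_3) = 2%N))%type.
Proof. by []. Qed.

Lemma sum3E (V : nmodType) (F : 'I_3 -> V) : \sum_i F i = F 0 + F 1 + F 2.
Proof.
rewrite !big_ord_recl big_ord0 addr0 addrA.
by congr (_ + F _ + F _); apply: val_inj.
Qed.

Section Cross.
Variable K : fieldType.
Implicit Types (x y z u v w : 'rV[K]_3) (A S M N : 'M[K]_3) (a c g : K).

Lemma row3P x y : x 0 0 = y 0 0 -> x 0 1 = y 0 1 -> x 0 2 = y 0 2 -> x = y.
Proof. by move=> h0 h1 h2; apply/rowP; apply: ord3_ind. Qed.

Definition cross x y : 'rV[K]_3 :=
  \row_j (x 0 (j + 1) * y 0 (j + 2) - x 0 (j + 2) * y 0 (j + 1)).

Lemma cross0E x y : cross x y 0 0 = x 0 1 * y 0 2 - x 0 2 * y 0 1.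
Proof. by rewrite mxE !ord3_addE. Qed.
Lemma cross1E x y : cross x y 0 1 = x 0 2 * y 0 0 - x 0 0 * y 0 2.
Proof. by rewrite mxE !ord3_addE. Qed.
Lemma cross2E x y : cross x y 0 2 = x 0 0 * y 0 1 - x 0 1 * y 0 0.
Proof. by rewrite mxE !ord3_addE. Qed.

Definition crossE := (cross0E, cross1E, cross2E).

Definition dot n (x y : 'rV[K]_n) : K := \sum_i x 0 i * y 0 i.
Definition bil A x y : K := \sum_i \sum_j x 0 i * A i j * y 0 j.
Definition tau S x N : K := \sum_i \sum_j cross x (row i S) 0 j * N i j.

(* The form with matrices [A], [S] and scalar [g] evaluated at [(x, u, M)] and
   [(y, v, N)]. The coefficient of [N i j] in [tau S x N] is
   [B(x, [Y_i, X_j]) = - B(x * X_j, Y_i)]. *)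
Definition beta A g S x u M y v N : K :=
  bil A x y + g * (dot x v + dot u y) + bil S u v + tau S x N + tau S y M.

Lemma crossC x y : cross x y = - cross y x.
Proof. by apply: row3P; rewrite !mxE !ord3_addE; ring. Qed.

Lemma cross_linearl y : linear (cross^~ y).
Proof. by move=> a x z; apply: row3P; rewrite !mxE !ord3_addE; ring. Qed.
Lemma cross_linearr x : linear (cross x).
Proof. by move=> a y z; apply: row3P; rewrite !mxE !ord3_addE; ring. Qed.
HB.instance Definition _ x :=
  GRing.isLinear.Build K 'rV[K]_3 'rV[K]_3 _ (cross x) (cross_linearr x).

Lemma cross0l x : cross 0 x = 0.
Proof. by rewrite crossC linear0 oppr0. Qed.

Lemma cross_self x : cross x x = 0.
Proof. by apply: row3P; rewrite !crossE mxE; ring. Qed.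

Lemma cross_eq0 x y : x != 0 -> cross x y = 0 -> exists a, y = a *: x.
Proof.
move=> /rV0Pn [i xi] /rowP h.
have h0 := h 0; have h1 := h 1; have h2 := h 2.
move: h0 h1 h2; rewrite !crossE !mxE => h0 h1 h2.
(* Coordinate [i] of [x] is nonzero; once it is cleared, each coordinate equation is trivial or, up
   to sign, one of the vanishing minors. *)
exists (y 0 i / x 0 i); move: i xi; apply: ord3_ind => xi;
  apply: row3P; rewrite !mxE; apply: (mulfI xi);
  rewrite mulrA [_ * (_ / _)]mulrC divfK //; apply: subr0_eq;
  first [ ring
    | etransitivity; [|exact: h0]; ring | etransitivity; [|exact: h1]; ring
    | etransitivity; [|exact: h2]; ring
    | apply: oppr_inj; rewrite oppr0;
      first [ etransitivity; [|exact: h0]; ring | etransitivity; [|exact: h1]; ring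
            | etransitivity; [|exact: h2]; ring ] ].
Qed.

Lemma dotC n (x y : 'rV[K]_n) : dot x y = dot y x.
Proof. by apply: eq_bigr => i _; rewrite mulrC. Qed.
Lemma dot_linearr n (x : 'rV[K]_n) : scalar (dot x).
Proof.
move=> a y z; rewrite /dot mulr_sumr -big_split; apply: eq_bigr => i _ /=.
by rewrite !mxE; ring.
Qed.
HB.instance Definition _ n (x : 'rV[K]_n) :=
  GRing.isLinear.Build K 'rV[K]_n K _ (@dot n x) (@dot_linearr n x).
Lemma dotDr n (x y z : 'rV[K]_n) : dot z (x + y) = dot z x + dot z y.
Proof. exact: linearD. Qed.
Lemma dotZr n a (x z : 'rV[K]_n) : dot z (a *: x) = a * dot z x.
Proof. exact: linearZ. Qed.
Lemma dotNr n (x z : 'rV[K]_n) : dot z (- x) = - dot z x.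
Proof. exact: linearN. Qed.
Lemma dotDl n (x y z : 'rV[K]_n) : dot (x + y) z = dot x z + dot y z.
Proof. by rewrite dotC dotDr ![dot z _]dotC. Qed.
Lemma dotZl n a (x z : 'rV[K]_n) : dot (a *: x) z = a * dot x z.
Proof. by rewrite dotC dotZr [dot z _]dotC. Qed.
Lemma dotNl n (x z : 'rV[K]_n) : dot (- x) z = - dot x z.
Proof. by rewrite dotC dotNr [dot z _]dotC. Qed.

Lemma bil_mul A x y : bil A x y = dot (x *m A) y.
Proof. by rewrite /bil /dot exchange_big; apply: eq_bigr => j _; rewrite mxE mulr_suml. Qed.
Lemma bilC A x y : A^T = A -> bil A x y = bil A y x.
Proof.
move=> At; rewrite /bil exchange_big; do 2!apply: eq_bigr => ? _.
by rewrite -[in RHS]At [A^T _ _]mxE; ring.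
Qed.
Lemma bil_linearl A y : scalar (bil A ^~ y).
Proof. by move=> a x z; rewrite !bil_mul mulmxDl -scalemxAl dotDl dotZl. Qed.
Lemma bil_linearr A x : scalar (bil A x).
Proof. by move=> a y z; rewrite !bil_mul dot_linearr. Qed.

Lemma tau_linearl S N : scalar (fun x => tau S x N).
Proof.
move=> a x y; rewrite /tau mulr_sumr -big_split; apply: eq_bigr => i _ /=.
rewrite mulr_sumr -big_split; apply: eq_bigr => j _ /=.
by rewrite cross_linearl !mxE; ring.
Qed.
Lemma tau_linearr S x : scalar (tau S x).
Proof.
move=> a M N; rewrite /tau mulr_sumr -big_split; apply: eq_bigr => i _ /=.
rewrite mulr_sumr -big_split; apply: eq_bigr => j _ /=.
by rewrite [(a *: M + N) i j]mxE [(a *: M) i j]mxE; ring.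
Qed.

HB.instance Definition _ A x :=
  GRing.isLinear.Build K 'rV[K]_3 K _ (bil A x) (bil_linearr A x).
(* [tau] with its arguments exchanged, to carry the linearity in [x]. *)
Definition tauV S N x := tau S x N.
HB.instance Definition _ S N :=
  GRing.isLinear.Build K 'rV[K]_3 K _ (tauV S N) (tau_linearl S N).
HB.instance Definition _ S x :=
  GRing.isLinear.Build K 'M[K]_3 K _ (tau S x) (tau_linearr S x).

Lemma bil0 x y : bil 0 x y = 0.
Proof. by rewrite bil_mul mulmx0 dotC linear0. Qed.
Lemma tau0 x N : tau 0 x N = 0.
Proof.
by rewrite /tau big1 // => i _; rewrite big1 // => j _; rewrite row0 linear0 mxE mul0r.
Qed.

(** [u^T *m w] holds the coordinates of the bracket of the degree-two element [u] with the linear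
    element [w], so this is the invariance [B(x, [u, w]) = - B(u, [x, w])]. *)
Lemma tau_outer S x u w : tau S x (u^T *m w) = - bil S u (cross x w).
Proof.
rewrite /tau /bil -sumrN; apply: eq_bigr => i _.
by rewrite -sumrN !sum3E !crossE !mxE !big_ord1 !mxE; ring.
Qed.

Lemma dot_cross x y z : dot (cross x y) z = dot x (cross y z).
Proof. by rewrite /dot !sum3E !crossE; ring. Qed.

Lemma dot_crossl x y : dot x (cross x y) = 0.
Proof. by rewrite /dot !sum3E !crossE; ring. Qed.

Lemma dot_eq0 x : (forall y, dot x y = 0) -> x = 0.
Proof.
move=> h; apply/rowP => i; rewrite mxE -(h (delta_mx 0 i)) /dot.
rewrite (bigD1 i) //= mxE !eqxx mulr1 big1 ?addr0 // => j /negPf ji.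
by rewrite mxE eqxx ji mulr0.
Qed.

Lemma dot_row1 x i : dot x (row i 1%:M) = x 0 i.
Proof.
rewrite /dot (bigD1 i) //= !mxE eqxx mulr1 big1 ?addr0 // => j /negPf ji.
by rewrite !mxE eq_sym ji mulr0.
Qed.

Lemma bil_row1 S x i j :
  bil S (row i 1%:M) (cross x (row j 1%:M)) = - cross x (row i S) 0 j.
Proof. by rewrite bil_mul -row_mul mul1mx -dot_cross dot_row1 crossC mxE. Qed.

(** Matrices [N] with a single nonzero row isolate one vector [cross x (row i S)] at a time. *)
Lemma tau_eq0 S x : (forall N, tau S x N = 0) <-> forall i, cross x (row i S) = 0.
Proof.
split=> [h i|h N]; last first.
  by rewrite /tau big1 // => i _; rewrite big1 // => j _; rewrite h mxE mul0r.
apply: dot_eq0 => w; rewrite -(h ((delta_mx 0 i)^T *m w)) /tau (bigD1 i) //=.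
rewrite [X in _ + X]big1 ?addr0 => [|k /negPf ki].
  by apply: eq_bigr => j _; rewrite !mxE big_ord1 !mxE !eqxx mul1r.
by rewrite big1 // => j _; rewrite [X in _ * X]mxE big_ord1 !mxE eqxx ki mul0r mulr0.
Qed.

(** Duality for a linear system: values [c] prescribed for the functionals [tau S (row i R)] are
    attained once they respect every linear relation [d] among these functionals. *)
Lemma tau_solve S (R : 'M[K]_3) (c : 'rV[K]_3) :
  (forall d : 'rV_3, (forall N, tau S (d *m R) N = 0) -> dot c d = 0) ->
  exists N, forall i, tau S (row i R) N = c 0 i.
Proof.
(* Column [i] of [W] represents [tau S (row i R)] on vectorized matrices. *)
pose W := \matrix_(k < 3 * 3, i < 3) tau S (row i R) (vec_mx (delta_mx 0 k)).
have tauW N i : tau S (row i R) N = (mxvec N *m W) 0 i.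
  rewrite -[N in LHS]mxvecK [mxvec N in LHS]row_sum_delta !linear_sum mxE /=.
  by apply: eq_bigr => k _; rewrite !linearZ /= mxE.
move=> h; have /submxP[D cD] : (c <= W)%MS.
  rewrite submxE; apply/eqP/matrixP => i k; rewrite [RHS]mxE [i]ord1.
  (* A column of [cokermx W] is a relation among the functionals, so [c] annihilates it and lies in
     the row space of [W]. *)
  pose d := (col k (cokermx W))^T.
  rewrite -(h d) => [|N]; first by rewrite mxE /dot; apply: eq_bigr => j _; rewrite !mxE.
  rewrite -[LHS]/(tauV S N _) mulmx_sum_row linear_sum /=.
  have -> : \sum_i tauV S N (d 0 i *: row i R) = (mxvec N *m (W *m cokermx W)) 0 k.
    rewrite mulmxA mxE; apply: eq_bigr => j _.
    by rewrite linearZ /= [tauV _ _ _]tauW !mxE mulrC.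
  by rewrite mulmx_coker mulmx0 mxE.
by exists (vec_mx D) => i; rewrite tauW vec_mxK cD.
Qed.

(** A vector whose cross products with all rows vanish is a common direction of the rows; for
    [S = 0] any nonzero vector serves. *)
Lemma rank_le1_cross S :
  (\rank S <= 1)%N <-> exists2 x, x != 0 & forall i, cross x (row i S) = 0.
Proof.
split=> [r1|[x x0 h]]; last first.
  apply: leq_trans (rank_leq_row x); apply: mxrankS; apply/row_subP => i.
  by have [a ->] := cross_eq0 x0 (h i); apply: scalemx_sub.
have [S0|S0] := eqVneq S 0.
  exists (delta_mx 0 0) => [|i]; last by rewrite S0 row0 linear0.
  by apply/rV0Pn; exists 0; rewrite mxE !eqxx oner_neq0.
have [i ri] : exists i, row i S != 0.
  apply/existsP; apply: contraNT S0; rewrite negb_exists => /forallP h.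
  by apply/eqP/row_matrixP => i; rewrite row0; apply/eqP; have := h i; rewrite negbK.
exists (row i S) => // j.
have /andP[_ Si] : (row i S == S)%MS.
  by rewrite -(geq_leqif (mxrank_leqif_eq (row_sub i S))) rank_rV ri.
have /sub_rVP[a ->] := submx_trans (row_sub j S) Si.
rewrite linearZ /=; apply/eqP; rewrite scaler_eq0; apply/orP; right.
by apply/eqP/row3P; rewrite !crossE !mxE; ring.
Qed.

Lemma rank_ge2_ker S u v : (2 <= \rank S)%N -> u != 0 -> u *m S = 0 -> v *m S = 0 ->
  exists a, v = a *: u.
Proof.
move=> rS u0 uS vS; apply/sub_rVP; apply: submx_trans (_ : kermx S <= u)%MS.
  by apply/sub_kermxP.
have uk : (u <= kermx S)%MS by apply/sub_kermxP.
rewrite -(geq_leqif (mxrank_leqif_sup uk)) rank_rV u0 mxrank_ker.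
by rewrite leq_subLR addn1.
Qed.

Lemma beta_linear A g S a x u M y v N z w O :
  beta A g S (a *: x + y) (a *: u + v) (a *: M + N) z w O =
  a * beta A g S x u M z w O + beta A g S y v N z w O.
Proof.
rewrite /beta bil_linearl [bil S _ w]bil_linearl tau_linearl tau_linearr.
rewrite !(dotDl, dotZl); ring.
Qed.

Lemma beta_sym A g S x u M y v N : A^T = A -> S^T = S ->
  beta A g S x u M y v N = beta A g S y v N x u M.
Proof.
move=> At St; rewrite /beta (bilC x y At) (bilC u v St) [dot x v]dotC [dot u y]dotC.
ring.
Qed.

(** After [tau_outer] both sides contain the same three values of [bil S], by symmetry of [S], and
    the [g] terms are the triple product of [x], [y], [z] read in two ways. *)
Lemma beta_invariant A g S x u M y v N z w O : S^T = S ->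
  beta A g S 0 (cross x y) (u^T *m y - v^T *m x) z w O =
  beta A g S x u M 0 (cross y z) (v^T *m z - w^T *m y).
Proof.
move=> St; rewrite /beta !linearB /= !tau_outer.
rewrite (bilC (cross x y) w St) !bil_mul mul0mx -/(tauV S O 0) -/(tauV S M 0).
rewrite !(dotC 0) !linear0.
rewrite (crossC z y) (crossC z x) !dotNr -(dot_cross x y z); ring.
Qed.

Lemma beta_0r A g S x u M v N :
  beta A g S x u M 0 v N = g * dot x v + bil S u v + tau S x N.
Proof.
rewrite /beta !bil_mul -/(tauV S M 0) !linear0; ring.
Qed.

Lemma mulmx_trE (P Q : 'M[K]_3) S i j :
  (P *m S *m Q^T) i j = bil S (row i P) (row j Q).
Proof.
rewrite mxE bil_mul /dot; apply: eq_bigr => k _.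
by rewrite -row_mul [row i _ _ _]mxE [row j _ _ _]mxE [_^T _ _]mxE.
Qed.

End Cross.

(** * Coordinates in an algebra with three generators *)

Lemma lbr_suml (K : fieldType) (L : lieAlgType K) (I : finType) (F : I -> L) z :
  lbr (\sum_i F i) z = \sum_i lbr (F i) z.
Proof. by apply: (big_morph (lbr^~ z)) => [x y|]; rewrite ?lbrDl ?lbr0l. Qed.

Lemma lbr_sumr (K : fieldType) (L : lieAlgType K) (I : finType) (F : I -> L) z :
  lbr z (\sum_i F i) = \sum_i lbr z (F i).
Proof. by apply: (big_morph (lbr z)) => [x y|]; rewrite ?lbrDr ?lbr0r. Qed.

Section ThreeGenerators.
Variables (K : fieldType) (L : lieAlgType K) (X : 'I_3 -> L).
Implicit Types (x y u v w : 'rV[K]_3) (M N : 'M[K]_3).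

Definition gen2 (i : 'I_3) : L := lbr (X (i + 1)) (X (i + 2)).

Definition comb1 x : L := \sum_i x 0 i *: X i.
Definition comb2 u : L := \sum_i u 0 i *: gen2 i.
Definition comb3 M : L := \sum_i \sum_j M i j *: lbr (gen2 i) (X j).
Definition comb x u M : L := comb1 x + comb2 u + comb3 M.

Lemma comb1_linear : linear comb1.
Proof.
move=> a x y; rewrite /comb1 scaler_sumr -big_split; apply: eq_bigr => i _ /=.
by rewrite !mxE scalerDl scalerA.
Qed.
Lemma comb2_linear : linear comb2.
Proof.
move=> a x y; rewrite /comb2 scaler_sumr -big_split; apply: eq_bigr => i _ /=.
by rewrite !mxE scalerDl scalerA.
Qed.
Lemma comb3_linear : linear comb3.
Proof.
move=> a M N; rewrite /comb3 scaler_sumr -big_split; apply: eq_bigr => i _ /=.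
rewrite scaler_sumr -big_split; apply: eq_bigr => j _ /=.
by rewrite [(a *: M + N) i j]mxE [(a *: M) i j]mxE scalerDl scalerA.
Qed.
HB.instance Definition _ := GRing.isLinear.Build K 'rV[K]_3 L _ comb1 comb1_linear.
HB.instance Definition _ := GRing.isLinear.Build K 'rV[K]_3 L _ comb2 comb2_linear.
HB.instance Definition _ := GRing.isLinear.Build K 'M[K]_3 L _ comb3 comb3_linear.

Lemma comb_linear a x u M y v N :
  a *: comb x u M + comb y v N = comb (a *: x + y) (a *: u + v) (a *: M + N).
Proof. by rewrite /comb !linearP !scalerDr addrACA [X in X + _]addrACA. Qed.

Lemma combD x u M y v N : comb x u M + comb y v N = comb (x + y) (u + v) (M + N).
Proof. by rewrite -[comb x u M]scale1r comb_linear !scale1r. Qed.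

Lemma comb0 : comb 0 0 0 = 0.
Proof. by rewrite /comb !linear0 !addr0. Qed.

Lemma combZ a x u M : a *: comb x u M = comb (a *: x) (a *: u) (a *: M).
Proof. by rewrite -[LHS]addr0 -comb0 comb_linear !addr0. Qed.

Lemma comb_l x : comb x 0 0 = comb1 x. Proof. by rewrite /comb !linear0 !addr0. Qed.
Lemma comb_m u : comb 0 u 0 = comb2 u. Proof. by rewrite /comb !linear0 add0r addr0. Qed.
Lemma comb_r M : comb 0 0 M = comb3 M. Proof. by rewrite /comb !linear0 !add0r. Qed.

Lemma comb1_row i (P : 'M_3) : comb1 (row i P) = \sum_j P i j *: X j.
Proof. by apply: eq_bigr => j _; rewrite mxE. Qed.

Lemma comb1_delta i : comb1 (row i 1%:M) = X i.
Proof.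
rewrite comb1_row (bigD1 i) //= mxE eqxx scale1r big1 ?addr0 // => j /negPf ji.
by rewrite mxE eq_sym ji scale0r.
Qed.

Lemma lbr_comb11 x y : lbr (comb1 x) (comb1 y) = comb2 (cross x y).
Proof.
rewrite /comb1 lbr_suml.
under eq_bigr do rewrite lbr_sumr.
under eq_bigr do under eq_bigr do rewrite lbrZl lbrZr scalerA.
rewrite /comb2 !sum3E !crossE /gen2 !ord3_addE !lbrxx !scaler0 add0r !addr0.
rewrite [lbr (X 1) (X 0)]lbrC [lbr (X 2) (X 1)]lbrC [lbr (X 0) (X 2)]lbrC.
rewrite !scalerN !scalerBl.
by rewrite !addrA [LHS](ACl (4*6*5*2*1*3)).
Qed.

Lemma lbr_comb21 u y : lbr (comb2 u) (comb1 y) = comb3 (u^T *m y).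
Proof.
rewrite /comb1 /comb2 lbr_suml; apply: eq_bigr => i _.
rewrite lbr_sumr; apply: eq_bigr => j _.
by rewrite lbrZl lbrZr scalerA mxE big_ord1 mxE.
Qed.

Lemma lbr_comb12 x v : lbr (comb1 x) (comb2 v) = - comb3 (v^T *m x).
Proof. by rewrite lbrC lbr_comb21. Qed.

Lemma gen2_comb2 i : gen2 i = comb2 (row i 1%:M).
Proof.
rewrite /comb2 (bigD1 i) //= !mxE eqxx scale1r big1 ?addr0 // => j /negPf ji.
by rewrite !mxE eq_sym ji scale0r.
Qed.

Lemma comb3_scalar a : comb3 a%:M = 0.
Proof.
have -> : comb3 a%:M = a *: (\sum_i lbr (gen2 i) (X i)).
  rewrite /comb3 scaler_sumr; apply: eq_bigr => i _.
  rewrite (bigD1 i) //= mxE eqxx mulr1n big1 ?addr0 // => j /negPf ji.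
  by rewrite mxE eq_sym ji scale0r.
rewrite sum3E /gen2 !ord3_addE !(lbrC (lbr _ _)).
by rewrite -!opprD lbr_jacobi oppr0 scaler0.
Qed.

Hypothesis nil3 : forall a b c d : L, lbr (lbr (lbr a b) c) d = 0.

Lemma lbr_lcs2 (a b c d : L) : lbr (lbr a b) (lbr c d) = 0.
Proof.
have := lbr_jacobi (lbr a b) c d.
have -> : lbr c (lbr d (lbr a b)) = 0 by rewrite lbrC (lbrC d) lbrNl nil3 !oppr0.
by rewrite [lbr d (lbr _ c)]lbrC nil3 oppr0 !addr0.
Qed.

Lemma lbr_comb22 u v : lbr (comb2 u) (comb2 v) = 0.
Proof.
rewrite lbr_suml big1 // => i _; rewrite lbr_sumr big1 // => j _.
by rewrite lbrZl lbrZr lbr_lcs2 !scaler0.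
Qed.

Lemma lbr_comb3 M z : lbr (comb3 M) z = 0.
Proof.
rewrite lbr_suml big1 // => i _; rewrite lbr_suml big1 // => j _.
by rewrite lbrZl nil3 scaler0.
Qed.

Lemma lbr_comb x u M y v N :
  lbr (comb x u M) (comb y v N) = comb 0 (cross x y) (u^T *m y - v^T *m x).
Proof.
rewrite /comb !lbrDl !lbrDr lbr_comb3 ![lbr _ (comb3 N)]lbrC !lbr_comb3 !oppr0.
rewrite lbr_comb22 lbr_comb11 lbr_comb21 lbr_comb12 !addr0.
by rewrite linearB linear0 /= add0r -!addrA; congr (_ + _); rewrite addrC.
Qed.

End ThreeGenerators.

Lemma morph_lin (K : fieldType) (L M : lieAlgType K) (f : L -> M) :
  lie_morphism f -> {g : {linear L -> M} | f =1 g}.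
Proof.
move=> [fl _].
pose m := GRing.isLinear.Build K L M _ f fl.
by exists (HB.pack_for {linear L -> M} f m).
Qed.

Section MorphComb.
Variables (K : fieldType) (L M : lieAlgType K) (X : 'I_3 -> L) (f : L -> M).
Hypothesis fP : lie_morphism f.

Lemma morph_comb x u N : f (comb X x u N) = comb (f \o X) x u N.
Proof.
have [fl fb] := fP; have [g fg] := morph_lin fP.
rewrite fg /comb !linearD !linear_sum /=; congr (_ + _ + _).
- by apply: eq_bigr => i _; rewrite linearZ -fg.
- by apply: eq_bigr => i _; rewrite linearZ -fg fb.
- apply: eq_bigr => i _; rewrite linear_sum; apply: eq_bigr => j _.
  by rewrite linearZ -fg /gen2 !fb.
Qed.

End MorphComb.

Lemma morph_comp (K : fieldType) (L M N : lieAlgType K) (f : M -> N) (g : L -> M) :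
  lie_morphism f -> lie_morphism g -> lie_morphism (f \o g).
Proof.
by move=> [fl fb] [gl gb]; split=> [a x y|x y] /=; rewrite ?gl ?fl ?gb ?fb.
Qed.

(** * The free nilpotent algebra *)

Section LowerCentral.
Variables (K : fieldType).
Implicit Types (L M : lieAlgType K).

Lemma lcs_sub L i (A : set L) : is_subspace A ->
  (forall x y, lcs L i.+1 x -> A (lbr x y)) -> forall x, lcs L i.+2 x -> A x.
Proof.
move=> sA hA x; rewrite lcsS; apply: smallest_sub => //.
by move=> _ [y ly] [z _ <-]; apply: hA.
Qed.

Lemma lcs_br L i (x y : L) : lcs L i.+1 x -> lcs L i.+2 (lbr x y).
Proof. by move=> lx; rewrite lcsS; apply: sub_gen_smallest; exists x => //; exists y. Qed.

Lemma lcs_quot L (I : lie_ideal L) i y :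
  lcs (lie_quot I) i.+1 y -> exists2 x, lcs L i.+1 x & lie_proj I x = y.
Proof.
elim: i y => [|i IH] y; first by move=> _; exists (repr y); rewrite ?lie_reprK.
apply: (@lcs_sub _ _ (fun y => exists2 x, lcs L i.+2 x & lie_proj I x = y)).
  split; first by exists 0; [exact: (lie_ideal0 (lcs_ideal L i.+2))|].
  move=> a _ _ [x lx <-] [z lz <-]; exists (a *: x + z).
    exact: (@lie_idealP1 _ _ (lcs_ideal L i.+2)).
  by rewrite (lie_proj_morphism I).1.
move=> _ z /IH[x lx <-]; exists (lbr x (repr z)); first exact: lcs_br.
by rewrite (lie_proj_morphism I).2 lie_reprK.
Qed.

Lemma lcs_morph L M (f : L -> M) i x : lie_morphism f -> lcs L i x -> lcs M i (f x).
Proof.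
move=> fP; have [fl fb] := fP; have [g fg] := morph_lin fP.
elim: i x => [|[|i] IH] x //; apply: (@lcs_sub _ _ (fun x => lcs M i.+2 (f x))).
  split; first by rewrite fg linear0; exact: (lie_ideal0 (lcs_ideal M i.+2)).
  move=> a u v lu lv; rewrite fl; exact: (@lie_idealP1 _ _ (lcs_ideal M i.+2)).
by move=> y z ly; rewrite fb; apply: lcs_br; exact: IH.
Qed.

Section FreeNilpotent.
Variables (d t : nat).
Let L := free_nilp K d t.
Let X : 'I_d -> L := nilp_gen K t.

Lemma free_nilp_lcs0 (x : L) : lcs L t.+1 x -> x = 0.
Proof.
move=> /lcs_quot[y ly <-]; rewrite -lie_proj0; apply/lie_projP.
by rewrite subr0.
Qed.

(** Universal property: a morphism respects the lower central series, whose term [t.+1] is zero in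
    [M], so the lift from the free Lie algebra does not depend on the representative. *)
Lemma nilp_lift M (g : 'I_d -> M) : (forall y, lcs M t.+1 y -> y = 0) ->
  exists f : L -> M, lie_morphism f /\ forall i, f (X i) = g i.
Proof.
move=> M0; pose F := free_lift g; have FP : lie_morphism F := free_lift_morphism g.
have [G FG] := morph_lin FP; have [fl fb] := FP.
pose f (x : L) : M := F (repr x).
have fE z : f (lie_proj (lcs_ideal (free_lie K d) t.+1) z) = F z.
  apply/subr0_eq; rewrite /f !FG -linearB -FG; apply/M0/lcs_morph => //.
  exact: (lie_repr_proj (lcs_ideal (free_lie K d) t.+1)).
exists f; split; last by move=> i; rewrite fE; apply: free_lift_gen.
split=> [a x y|x y]; rewrite -(lie_reprK x) -(lie_reprK y).
  by rewrite -(lie_proj_morphism _).1 !fE fl.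
by rewrite -(lie_proj_morphism _).2 !fE fb.
Qed.

Lemma nilp_morph_eq M (f g : L -> M) : lie_morphism f -> lie_morphism g ->
  (forall i, f (X i) = g (X i)) -> f =1 g.
Proof.
move=> fP gP fg x; rewrite -(lie_reprK x).
have pP := lie_proj_morphism (lcs_ideal (free_lie K d) t.+1).
rewrite -[f _]/((f \o lie_proj _) (repr x)) -[g _]/((g \o lie_proj _) (repr x)).
rewrite (free_lift_unique (morph_comp fP pP) (fun i => fg i)).
by rewrite (free_lift_unique (morph_comp gP pP) (fun i => erefl)).
Qed.

Lemma nilp_ind (A : set L) : is_subspace A -> (forall i, A (X i)) ->
  (forall x y, A x -> A y -> A (lbr x y)) -> forall x, A x.
Proof.
move=> [A0 AP] AX Abr x; rewrite -(lie_reprK x) -(free_reprK (repr x)).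
have [pl pb] := lie_proj_morphism (lcs_ideal (free_lie K d) t.+1).
elim: (repr (repr x)) => [i| |u IHu v IHv|a u IHu|u IHu v IHv].
- exact: AX.
- by rewrite free_class0; exact: A0.
- by rewrite free_classD -[free_class u]scale1r pl; apply: AP.
- rewrite free_classZ -[_ *: free_class u]addr0 pl; exact: AP.
- by rewrite free_class_br pb; apply: Abr.
Qed.

End FreeNilpotent.
End LowerCentral.

(** * A coordinate model in classes two and three *)

(* The scalar [c] multiplies the brackets of degree three: [c = 1] gives the
   free algebra of class three and [c = 0] that of class two. *)
Definition nilp_model (K : fieldType) (c : K) : Type :=
  ('rV[K]_3 * 'rV[K]_3 * 'M[K]_3)%type.

Section Model.
Variables (K : fieldType) (c : K).

Local Notation model := (nilp_model c).

HB.instance Definition _ :=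
  GRing.Lmodule.copy model ('rV[K]_3 * 'rV[K]_3 * 'M[K]_3)%type.

(* The third component represents a matrix modulo scalar matrices by the
   representative whose entry at [(0, 0)] vanishes. *)
Definition tensor (u y : 'rV[K]_3) : 'M[K]_3 := u^T *m y - (u 0 0 * y 0 0)%:M.

Definition model_br (p q : model) : model :=
  (0, cross p.1.1 q.1.1, c *: (tensor p.1.2 q.1.1 - tensor q.1.2 p.1.1)).

Lemma modelP (p q : model) : p.1.1 = q.1.1 -> p.1.2 = q.1.2 -> p.2 = q.2 -> p = q.
Proof. by case: p => [[? ?] ?]; case: q => [[? ?] ?] /= -> -> ->. Qed.

Lemma tensor_linearl y : linear (tensor^~ y).
Proof.
move=> a u v; rewrite /tensor linearP mulmxDl -scalemxAl scalerBr addrACA -opprD.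
by congr (_ - _); rewrite scale_scalar_mx -raddfD !mxE mulrDl mulrA.
Qed.
Lemma tensor_linearr u : linear (tensor u).
Proof.
move=> a x y; rewrite /tensor mulmxDr -scalemxAr scalerBr addrACA -opprD.
by congr (_ - _); rewrite scale_scalar_mx -raddfD !mxE mulrDr mulrCA.
Qed.

Lemma model_br_linearr p : linear (model_br p).
Proof.
move=> a q r; apply: modelP => /=.
- by rewrite scaler0 addr0.
- exact: cross_linearr.
- rewrite tensor_linearl tensor_linearr scalerA mulrC -scalerA -scalerDr; congr (_ *: _).
  by rewrite [in RHS]scalerBr [RHS]addrACA -opprD.
Qed.
Lemma model_brC p q : model_br p q = - model_br q p.
Proof.
apply: modelP => /=; first by rewrite oppr0.
  by rewrite crossC.
by rewrite -scalerN; congr (_ *: _); rewrite [RHS]opprB.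
Qed.
Lemma model_br_linearl q : linear (model_br^~ q).
Proof.
move=> a p r /=; rewrite ![model_br _ q]model_brC model_br_linearr.
by rewrite scalerN opprD.
Qed.
Lemma model_brxx p : model_br p p = 0.
Proof.
apply: modelP; rewrite //= ?subrr ?scaler0 //.
by apply: row3P; rewrite !crossE mxE; ring.
Qed.
Lemma model_jacobi p q r :
  model_br p (model_br q r) + model_br q (model_br r p) + model_br r (model_br p q) = 0.
Proof.
have t0 y : tensor 0 y = 0.
  by rewrite /tensor trmx0 mul0mx mxE mul0r raddf0 subrr.
have c0 x : cross x 0 = 0 by rewrite linear0.
apply: modelP => /=; rewrite ?c0 ?addr0 //.
have tr0 u : tensor u 0 = 0.
  by rewrite /tensor mulmx0 mxE mulr0 raddf0 subrr.
rewrite !tr0 !sub0r -!scalerDr.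
(* The products [(cross q r)^T *m p] of linear parts, summed cyclically, give the scalar matrix of
   their determinant, and the normalization in [tensor] kills scalars. *)
rewrite (_ : _ + _ + _ = 0) ?scaler0 //.
apply/matrixP => i j; move: i; apply: ord3_ind; move: j; apply: ord3_ind;
  rewrite /tensor !mxE !big_ord1 !mxE !ord3_addE /=; ring.
Qed.

HB.instance Definition _ := Lmodule_isLieAlgebra.Build K model
  model_br_linearl model_br_linearr model_brxx model_jacobi.

Lemma model_lcs2 p : lcs model 2 p -> p.1.1 = 0.
Proof.
apply: (@lcs_sub _ _ 0 (fun p : model => p.1.1 = 0)); last by move=> x y _.
by split=> // a u v /= -> ->; rewrite scaler0 addr0.
Qed.

Lemma model_lcs3 p : lcs model 3 p -> p.1.1 = 0 /\ p.1.2 = 0.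
Proof.
apply: (@lcs_sub _ _ 1 (fun p : model => p.1.1 = 0 /\ p.1.2 = 0)).
  by split=> // a u v /= [-> ->] [-> ->]; rewrite scaler0 addr0.
by move=> x y /model_lcs2 x0 /=; rewrite x0 crossC linear0 oppr0.
Qed.

Lemma model_lcs3_class2 p : c = 0 -> lcs model 3 p -> p = 0.
Proof.
move=> c0; apply: (@lcs_sub _ _ 1 (fun p : model => p = 0)).
  by split=> // a u v /= -> ->; rewrite scaler0 addr0.
move=> x y /model_lcs2 x0; apply: modelP; rewrite //= ?x0 ?cross0l //.
by rewrite c0 scale0r.
Qed.

Lemma model_lcs4 p : lcs model 4 p -> p = 0.
Proof.
apply: (@lcs_sub _ _ 2 (fun p : model => p = 0)).
  by split=> // a u v /= -> ->; rewrite scaler0 addr0.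
move=> x y /model_lcs3 [x0 x1]; apply: modelP; rewrite //= x0 ?x1.
  by rewrite crossC linear0 oppr0.
rewrite /tensor trmx0 mul0mx mulmx0 !mxE mul0r mulr0 !subrr; exact: scaler0.
Qed.

Definition model_gen (i : 'I_3) : model := (row i 1%:M, 0, 0).

Lemma gen2_model i : gen2 model_gen i = (0, row i 1%:M, 0) :> model.
Proof.
apply: modelP => //=.
  by move: i; apply: ord3_ind; apply: row3P; rewrite !ord3_addE !crossE !mxE /=; ring.
by rewrite /tensor trmx0 !mul0mx !mxE !mul0r subrr scaler0.
Qed.

Lemma tensor_sum (M : 'M[K]_3) :
  \sum_i \sum_j M i j *: tensor (row i 1%:M) (row j 1%:M) = M - (M 0 0)%:M.
Proof.
under eq_bigr do under eq_bigr do rewrite /tensor scalerBr.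
under eq_bigr do rewrite sumrB.
rewrite sumrB [in RHS](matrix_sum_delta M); congr (_ - _).
  by do 2!apply: eq_bigr => ? _; rewrite !rowE !mulmx1 trmx_delta mul_delta_mx.
rewrite !sum3E !scale_scalar_mx -!raddfD; congr (_%:M).
by rewrite !mxE /=; ring.
Qed.

Lemma comb_model_gen x u M :
  comb model_gen x u M = (x, u, c *: (M - (M 0 0)%:M)) :> model.
Proof.
rewrite /comb; have -> : comb1 model_gen x = (x, 0, 0).
  rewrite /comb1 sum3E; apply: modelP => /=; rewrite ?scaler0 ?addr0 //.
  by apply: row3P; rewrite !mxE /=; ring.
have -> : comb2 model_gen u = (0, u, 0).
  rewrite /comb2 sum3E !gen2_model; apply: modelP => /=; rewrite ?scaler0 ?addr0 //.
  by apply: row3P; rewrite !mxE /=; ring.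
have -> : comb3 model_gen M = (0, 0, c *: (M - (M 0 0)%:M)).
  rewrite /comb3 !sum3E !gen2_model; apply: modelP => /=.
  - by rewrite ?scaler0 ?addr0.
  - by rewrite !cross0l ?scaler0 ?addr0.
  have -> : tensor 0 0 = 0 by rewrite /tensor mulmx0 mxE mulr0 raddf0 subrr.
  rewrite !subr0 ![M _ _ *: (c *: _)]scalerA ![M _ _ * c]mulrC -!scalerA -!scalerDr.
  by congr (_ *: _); rewrite -tensor_sum !sum3E.
by apply: modelP; rewrite /= ?add0r ?addr0.
Qed.

End Model.

Lemma lie_ideal_sum (K : fieldType) (L : lieAlgType K) (I : lie_ideal L)
    (T : finType) (F : T -> L) : (forall i, I (F i)) -> I (\sum_i F i).
Proof.
by move=> h; apply: big_ind => // *; [apply: lie_ideal0 | apply: lie_idealD].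
Qed.

Notation gens b := (@nilp_gen _ 3 (nat_of_bool b).+2).

(* Classes two ([b = false]) and three ([b = true]) are treated at once. *)
Lemma nil3 (K : fieldType) (b : bool) (p q r s : free_nilp K 3 b.+2) :
  lbr (lbr (lbr p q) r) s = 0.
Proof.
have l3 : lcs (free_nilp K 3 b.+2) 3 (lbr (lbr p q) r) by do 2!apply: lcs_br.
case: b p q r s l3 => p q r s l3.
  by apply: (@free_nilp_lcs0 K 3 3); apply: lcs_br; exact: l3.
by rewrite (@free_nilp_lcs0 K 3 2 _ l3) lbr0l.
Qed.

Section FreeRank3.
Variables (K : fieldType) (b : bool).
Implicit Types (x y u v w : 'rV[K]_3) (M N : 'M[K]_3).

Local Notation L := (free_nilp K 3 b.+2).
Local Notation X := (gens b).

Lemma comb_surj (z : L) : exists x u M, z = comb X x u M.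
Proof.
move: z; apply: nilp_ind.
- split; first by exists 0, 0, 0; rewrite comb0.
  move=> a _ _ [x [u [M ->]]] [y [v [N ->]]]; rewrite comb_linear.
  by do 3!eexists.
- by move=> i; exists (row i 1%:M), 0, 0; rewrite comb_l comb1_delta.
- move=> _ _ [x [u [M ->]]] [y [v [N ->]]]; rewrite (lbr_comb _ (@nil3 _ _)).
  by do 3!eexists.
Qed.

(** The model with [c = b%:R] has the right nilpotency class to receive a morphism from the free
    nilpotent algebra, and the image of a combination displays its coordinates. *)
Lemma comb_inj x u M y v N : comb X x u M = comb X y v N ->
  [/\ x = y, u = v & b -> M - (M 0 0)%:M = N - (N 0 0)%:M].
Proof.
have nilm (p : nilp_model (b%:R : K)) : lcs (nilp_model (b%:R : K)) b.+3 p -> p = 0.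
  by case: b p => p; [exact: model_lcs4 | exact: model_lcs3_class2].
have [f [fP fX]] := nilp_lift (@model_gen K b%:R) nilm.
move=> /(congr1 f); rewrite !(morph_comb _ fP).
have -> : f \o X = @model_gen K b%:R by apply/funext.
by rewrite !comb_model_gen => -[-> -> h]; split=> // bT; move: h; rewrite bT !scale1r.
Qed.

Lemma lcs2_comb (z : L) : lcs L 2 z <-> exists u M, z = comb X 0 u M.
Proof.
split=> [|[u [M ->]]].
  apply: (@lcs_sub _ _ 0 (fun z : L => exists u M, z = comb X 0 u M)).
    split; first by exists 0, 0; rewrite comb0.
    move=> a _ _ [u [M ->]] [v [N ->]]; rewrite comb_linear scaler0 addr0.
    by do 2!eexists.
  move=> p q _; have [x [u [M ->]]] := comb_surj p; have [y [v [N ->]]] := comb_surj q.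
  by rewrite (lbr_comb _ (@nil3 _ _)); do 2!eexists.
have lD := @lie_idealD _ _ (lcs_ideal L 2); have lZ := @lie_idealZ _ _ (lcs_ideal L 2).
have lS := @lie_ideal_sum _ _ (lcs_ideal L 2).
rewrite /comb linear0 add0r; apply: lD.
  by apply: (lS 'I_3) => i; apply: lZ; apply: lcs_br.
by do 2!apply: (lS 'I_3) => ?; apply: lZ; apply: lcs_br.
Qed.

Lemma lcs3_comb (z : L) : lcs L 3 z <-> exists M, z = comb X 0 0 M.
Proof.
split=> [|[M ->]].
  apply: (@lcs_sub _ _ 1 (fun z : L => exists M, z = comb X 0 0 M)).
    split; first by exists 0; rewrite comb0.
    move=> a _ _ [M ->] [N ->]; rewrite comb_linear !scaler0 !addr0.
    by eexists.
  move=> p q /lcs2_comb[u [M ->]]; have [y [v [N ->]]] := comb_surj q.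
  by rewrite (lbr_comb _ (@nil3 _ _)) cross0l; eexists.
rewrite comb_r; do 2!apply: (@lie_ideal_sum _ _ (lcs_ideal L 3) 'I_3) => ?.
by apply: (@lie_idealZ _ _ (lcs_ideal L 3)); do 2!apply: lcs_br.
Qed.

Lemma comb3_class2 M : ~~ b -> comb3 X M = 0.
Proof.
move=> /negbTE bF; have : lcs L 3 (comb X 0 0 M) by apply/lcs3_comb; exists M.
rewrite comb_r; move: M; case: b bF => // _ M.
exact: (@free_nilp_lcs0 K 3 2).
Qed.

Lemma endo_exists (g : 'I_3 -> L) : exists f : L -> L, lie_morphism f /\ f \o X = g.
Proof.
have [f [fP fX]] := @nilp_lift K 3 b.+2 L g (@free_nilp_lcs0 _ _ _).
by exists f; split=> //; apply/funext.
Qed.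

End FreeRank3.

(** * Invariant forms in coordinates *)

Section InvariantForms.
Variables (K : fieldType) (L : lieAlgType K) (B : L -> L -> K).
Hypotheses (Blin : is_bilinear B) (Bsym : is_symmetric B) (Binv : is_invariant B).
Implicit Types (x y u v w : 'rV[K]_3) (M N : 'M[K]_3).

Lemma form_Pl a p q r : B (a *: p + q) r = a * B p r + B q r.
Proof. by case: Blin => h _; apply: h. Qed.
Lemma form_Pr a p q r : B r (a *: p + q) = a * B r p + B r q.
Proof. by case: Blin => _ h; apply: h. Qed.
Lemma form_Dr p q r : B r (p + q) = B r p + B r q.
Proof. by rewrite -[p in LHS]scale1r form_Pr mul1r. Qed.
Lemma form_Dl p q r : B (p + q) r = B p r + B q r.
Proof. by rewrite -[p in LHS]scale1r form_Pl mul1r. Qed.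
Lemma form_0r r : B r 0 = 0.
Proof. by apply: (addrI (B r 0)); rewrite -form_Dr !addr0. Qed.
Lemma form_Zr a p r : B r (a *: p) = a * B r p.
Proof. by rewrite -[a *: p]addr0 form_Pr form_0r addr0. Qed.
Lemma form_Zl a p r : B (a *: p) r = a * B p r.
Proof. by rewrite Bsym form_Zr Bsym. Qed.
Lemma form_Nr p r : B r (- p) = - B r p.
Proof. by rewrite -scaleN1r form_Zr mulN1r. Qed.
Lemma form_sumr (T : finType) (F : T -> L) r : B r (\sum_i F i) = \sum_i B r (F i).
Proof. by apply: (big_morph (B r)) => [p q|]; rewrite ?form_Dr ?form_0r. Qed.
Lemma form_suml (T : finType) (F : T -> L) r : B (\sum_i F i) r = \sum_i B (F i) r.
Proof. by rewrite Bsym form_sumr; apply: eq_bigr => i _; rewrite Bsym. Qed.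

Lemma form_cyc p q r : B p (lbr q r) = B r (lbr p q).
Proof. by rewrite -Binv Bsym. Qed.

Variable X : 'I_3 -> L.
Hypothesis nil3 : forall a b c d : L, lbr (lbr (lbr a b) c) d = 0.

Definition form11 : 'M[K]_3 := \matrix_(i, j) B (X i) (X j).
Definition form12 : K := B (X 0) (gen2 X 0).
Definition form22 : 'M[K]_3 := \matrix_(i, j) B (gen2 X i) (gen2 X j).

Lemma form11_sym : form11^T = form11.
Proof. by apply/matrixP => i j; rewrite !mxE Bsym. Qed.
Lemma form22_sym : form22^T = form22.
Proof. by apply/matrixP => i j; rewrite !mxE Bsym. Qed.

(** By invariance and symmetry [B(p, [q, r])] is cyclic and alternating, so on three generators one
    scalar determines it. *)
Lemma form_gen12 i j : B (X i) (gen2 X j) = form12 *+ (i == j).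
Proof.
have z1 p q : B p (lbr p q) = 0 by rewrite form_cyc lbrxx form_0r.
have z2 p q : B p (lbr q p) = 0 by rewrite lbrC form_Nr z1 oppr0.
rewrite /form12 /gen2; move: i; apply: ord3_ind; move: j; apply: ord3_ind;
  rewrite !ord3_addE /=; move: (X 0) (X 1) (X 2) => p q r;
  by rewrite ?z1 ?z2 // form_cyc // form_cyc.
Qed.

Lemma form_comb11 x y : B (comb1 X x) (comb1 X y) = bil form11 x y.
Proof.
rewrite form_suml; apply: eq_bigr => i _; rewrite form_sumr; apply: eq_bigr => j _.
by rewrite form_Zl form_Zr mxE mulrA mulrAC.
Qed.

Lemma form_comb22 u v : B (comb2 X u) (comb2 X v) = bil form22 u v.
Proof.
rewrite form_suml; apply: eq_bigr => i _; rewrite form_sumr; apply: eq_bigr => j _.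
by rewrite form_Zl form_Zr mxE mulrA mulrAC.
Qed.

Lemma form_comb12 x v : B (comb1 X x) (comb2 X v) = form12 * dot x v.
Proof.
rewrite form_suml mulr_sumr; apply: eq_bigr => i _; rewrite form_sumr (bigD1 i) //=.
rewrite big1 => [|j ji]; rewrite form_Zl form_Zr form_gen12.
  by rewrite eqxx addr0 mulr1n; ring.
by rewrite eq_sym (negPf ji) !mulr0.
Qed.

Lemma form_comb13 x N : B (comb1 X x) (comb3 X N) = tau form22 x N.
Proof.
rewrite form_sumr; apply: eq_bigr => i _; rewrite form_sumr; apply: eq_bigr => j _.
rewrite form_Zr mulrC; congr (_ * _).
rewrite lbrC form_Nr -Binv -[X j]comb1_delta lbr_comb11 gen2_comb2 form_comb22.
by rewrite bilC ?form22_sym // bil_row1 opprK.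
Qed.

(** Invariance moves a generator out of the left bracket onto an element of degree three, which it
    annihilates; the next lemma follows in the same way. *)
Lemma form_comb23 u N : B (comb2 X u) (comb3 X N) = 0.
Proof.
rewrite form_suml big1 // => i _; rewrite form_Zl.
by rewrite Binv lbrC (lbr_comb3 X nil3) oppr0 form_0r mulr0.
Qed.
Lemma form_comb33 M N : B (comb3 X M) (comb3 X N) = 0.
Proof.
rewrite form_suml big1 // => i _; rewrite form_suml big1 // => j _.
by rewrite form_Zl Binv lbrC (lbr_comb3 X nil3) oppr0 form_0r mulr0.
Qed.

Lemma form_beta x u M y v N : B (comb X x u M) (comb X y v N) =
  beta form11 form12 form22 x u M y v N.
Proof.
rewrite /comb !form_Dl !form_Dr form_comb11 form_comb12 form_comb13 form_comb22.
rewrite form_comb23 form_comb33 ![B (comb3 _ _) _]Bsym form_comb13 form_comb23.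
by rewrite [B (comb2 _ _) _]Bsym form_comb12 /beta [dot u y]dotC; ring.
Qed.

End InvariantForms.

(** * Gram matrices in the given bases *)

Lemma sum8E (V : nmodType) (F : 'I_8 -> V) :
  \sum_i F i = F 0 + F 1 + F 2 + F 3 + F 4 + F 5 + F 6 + F 7.
Proof.
rewrite !big_ord_recl big_ord0 addr0 !addrA.
by congr (_ + _ + _ + _ + _ + _ + _ + _); congr F; apply: val_inj.
Qed.

Lemma ord8_ind (P : 'I_8 -> Prop) :
  P 0 -> P 1 -> P 2 -> P 3 -> P 4 -> P 5 -> P 6 -> P 7 -> forall i, P i.
Proof.
move=> P0 P1 P2 P3 P4 P5 P6 P7 [[|[|[|[|[|[|[|[|//]]]]]]]] h].
- by rewrite (_ : Ordinal h = 0) //; apply: val_inj.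
- by rewrite (_ : Ordinal h = 1) //; apply: val_inj.
- by rewrite (_ : Ordinal h = 2) //; apply: val_inj.
- by rewrite (_ : Ordinal h = 3) //; apply: val_inj.
- by rewrite (_ : Ordinal h = 4) //; apply: val_inj.
- by rewrite (_ : Ordinal h = 5) //; apply: val_inj.
- by rewrite (_ : Ordinal h = 6) //; apply: val_inj.
- by rewrite (_ : Ordinal h = 7) //; apply: val_inj.
Qed.

Lemma ord8_val :
  ((nat_of_ord (0%R : 'I_8) = 0%N) * (nat_of_ord (1%R : 'I_8) = 1%N) *
   (nat_of_ord (2%R : 'I_8) = 2%N) * (nat_of_ord (3%R : 'I_8) = 3%N) *
   (nat_of_ord (4%R : 'I_8) = 4%N) * (nat_of_ord (5%R : 'I_8) = 5%N) *
   (nat_of_ord (6%R : 'I_8) = 6%N) * (nat_of_ord (7%R : 'I_8) = 7%N))%type.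
Proof. by []. Qed.

Lemma coordsE (K : fieldType) (L : lieAlgType K) n (e : n.-tuple L) (c : 'rV[K]_n) :
  (forall d : 'rV_n, \sum_i d 0 i *: tnth e i = \sum_i c 0 i *: tnth e i -> d = c) ->
  coords e (\sum_i c 0 i *: tnth e i) = c.
Proof. by move=> h; apply: xget_unique => // d /= /esym/h. Qed.

Section MatrixForms.
Variable K : fieldType.
Implicit Types (x y u v w : 'rV[K]_3) (M N A S : 'M[K]_3) (n : 'rV[K]_8) (g : K).

(* The six matrix entries off the diagonal and the two differences of diagonal
   entries are the coordinates of a matrix modulo scalars, in the order and
   with the signs given by the basis of degree three. *)
Definition row8 M : 'rV[K]_8 :=
  mx_of_rows 1 8 [:: [:: - M 2 0; - M 2 1; M 0 0 - M 2 2; M 1 0; M 1 1 - M 0 0;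
                        M 1 2; - M 0 1; - M 0 2]].
Definition mx8 n : 'M[K]_3 :=
  mx_of_rows 3 3 [:: [:: 0; - n 0 6; - n 0 7]; [:: n 0 3; n 0 4; n 0 5];
                     [:: - n 0 0; - n 0 1; - n 0 2]].

Lemma mx8_row8 M : mx8 (row8 M) = M - (M 0 0)%:M.
Proof.
apply/matrixP; apply: ord3_ind; apply: ord3_ind;
  rewrite !mxE ?ord3_val ?ord8_val /= ?mxE /=; ring.
Qed.

Lemma mx8_inj n n' : mx8 n = mx8 n' -> n = n'.
Proof.
move=> /matrixP h; apply/rowP; apply: ord8_ind.
- by apply: oppr_inj; have := h 2 0; rewrite !mxE ?ord3_val.
- by apply: oppr_inj; have := h 2 1; rewrite !mxE ?ord3_val.
- by apply: oppr_inj; have := h 2 2; rewrite !mxE ?ord3_val.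
- by have := h 1 0; rewrite !mxE ?ord3_val.
- by have := h 1 1; rewrite !mxE ?ord3_val.
- by have := h 1 2; rewrite !mxE ?ord3_val.
- by apply: oppr_inj; have := h 0 1; rewrite !mxE ?ord3_val.
- by apply: oppr_inj; have := h 0 2; rewrite !mxE ?ord3_val.
Qed.

Lemma mx8_00 n : mx8 n 0 0 = 0.
Proof. by rewrite mxE. Qed.

Lemma mulmx_Cmx u : u *m Cmx = \row_j nth 0 [:: u 0 2; - u 0 1; u 0 0] j.
Proof.
by apply: row3P; rewrite !mxE sum3E !mxE !ord3_val /=; ring.
Qed.

Lemma CmxK u : u *m Cmx *m Cmx = u.
Proof. by apply: row3P; rewrite !mulmx_Cmx !mxE !ord3_val /= ?mxE ?ord3_val /= ?opprK. Qed.

Lemma trmx_Cmx : (Cmx : 'M[K]_3)^T = Cmx.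
Proof. by apply/matrixP; apply: ord3_ind; apply: ord3_ind; rewrite !mxE ?ord3_val. Qed.

Lemma Cmx_sqr : Cmx *m Cmx = 1%:M :> 'M[K]_3.
Proof. by apply/row_matrixP => i; rewrite rowE [RHS]rowE mulmx1 mulmxA CmxK. Qed.

(** With indices from zero the basis brackets are [- Y_2], [Y_1], [- Y_0], so passing to the
    coordinates of [comb2] is multiplication by [- Cmx]. The sign of [g] and the conjugation by
    [Cmx] below originate here. *)
Lemma comb2_basis (L : lieAlgType K) (X : 'I_3 -> L) w :
  w 0 0 *: lbr (X 1) (X 0) + w 0 1 *: lbr (X 2) (X 0) + w 0 2 *: lbr (X 2) (X 1) =
  comb2 X (- (w *m Cmx)).
Proof.
rewrite mulmx_Cmx /comb2 !sum3E /gen2 !ord3_addE !mxE !ord3_val /= opprK.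
rewrite [lbr (X 1) (X 0)]lbrC [lbr (X 2) (X 1)]lbrC !scalerN -!scaleNr.
by rewrite [LHS](ACl (3*2*1)).
Qed.

Lemma comb3_basis (L : lieAlgType K) (X : 'I_3 -> L) n :
  n 0 0 *: lbr (lbr (X 1) (X 0)) (X 0) + n 0 1 *: lbr (lbr (X 1) (X 0)) (X 1) +
  n 0 2 *: lbr (lbr (X 1) (X 0)) (X 2) + n 0 3 *: lbr (lbr (X 2) (X 0)) (X 0) +
  n 0 4 *: lbr (lbr (X 2) (X 0)) (X 1) + n 0 5 *: lbr (lbr (X 2) (X 0)) (X 2) +
  n 0 6 *: lbr (lbr (X 2) (X 1)) (X 1) + n 0 7 *: lbr (lbr (X 2) (X 1)) (X 2) =
  comb3 X (mx8 n).
Proof.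
rewrite /comb3 !sum3E /gen2 !ord3_addE !mxE !ord3_val /=.
rewrite [lbr (X 1) (X 0)]lbrC [lbr (X 2) (X 1)]lbrC !lbrNl !scalerN -!scaleNr.
by rewrite scale0r add0r !addrA [LHS](ACl (7*8*4*5*6*1*2*3)).
Qed.

Lemma sum_basis32 x w :
  \sum_(i < 6) (row_mx x w) 0 i *: tnth (basis32 K) i =
  comb (gens false) x (- (w *m Cmx)) 0.
Proof.
rewrite (@big_split_ord _ _ _ 3 3) /=.
under eq_bigr do rewrite row_mxEl.
under [X in _ + X]eq_bigr do rewrite row_mxEr.
rewrite /comb linear0 addr0; congr (_ + _).
  by rewrite sum3E /comb1 sum3E; congr (_ *: _ + _ *: _ + _ *: _).
by rewrite -comb2_basis sum3E !(tnth_nth 0).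
Qed.

Lemma sum_basis33 x w n :
  \sum_(i < 14) (row_mx x (row_mx w n)) 0 i *: tnth (basis33 K) i =
  comb (gens true) x (- (w *m Cmx)) (mx8 n).
Proof.
rewrite (@big_split_ord _ _ _ 3 11) (@big_split_ord _ _ _ 3 8) /=.
under eq_bigr do rewrite row_mxEl.
under [X in _ + (X + _)]eq_bigr do rewrite row_mxEr row_mxEl.
under [X in _ + (_ + X)]eq_bigr do rewrite !row_mxEr.
rewrite /comb -addrA; congr (_ + (_ + _)).
- by rewrite sum3E /comb1 sum3E; congr (_ *: _ + _ *: _ + _ *: _).
- by rewrite -comb2_basis sum3E !(tnth_nth 0).
- by rewrite -comb3_basis sum8E !(tnth_nth 0).
Qed.

Lemma Cmx_inj u w : - (u *m Cmx) = - (w *m Cmx) -> u = w.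
Proof. by move=> /oppr_inj h; rewrite -(CmxK u) h CmxK. Qed.

Lemma comb_basis32 x u M : comb (gens false) x u M =
  \sum_(i < 6) (row_mx x (- (u *m Cmx))) 0 i *: tnth (basis32 K) i.
Proof.
rewrite sum_basis32 mulNmx opprK CmxK /comb linear0.
by rewrite (comb3_class2 (b := false)).
Qed.

Lemma comb_basis33 x u M : comb (gens true) x u M =
  \sum_(i < 14) (row_mx x (row_mx (- (u *m Cmx)) (row8 M))) 0 i *: tnth (basis33 K) i.
Proof.
rewrite sum_basis33 mulNmx opprK CmxK mx8_row8 /comb.
by rewrite linearB /= comb3_scalar subr0.
Qed.

Lemma coords32 x u M :
  coords (basis32 K) (comb (gens false) x u M) = row_mx x (- (u *m Cmx)).
Proof.
rewrite comb_basis32; apply: coordsE => d.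
rewrite -[d in LHS](@hsubmxK _ _ 3 3) !sum_basis32 => /(@comb_inj K false)[<- /Cmx_inj <- _].
by rewrite (@hsubmxK _ _ 3 3).
Qed.

Lemma coords33 x u M : coords (basis33 K) (comb (gens true) x u M) =
  row_mx x (row_mx (- (u *m Cmx)) (row8 M)).
Proof.
rewrite comb_basis33; apply: coordsE => d.
rewrite -[d in LHS](@hsubmxK _ _ 3 11) -[rsubmx _](@hsubmxK _ _ 3 8) !sum_basis33.
move=> /(@comb_inj K true)[<- /Cmx_inj <- /(_ isT)].
rewrite !mx8_00 raddf0 !subr0 => /mx8_inj <-.
by rewrite (@hsubmxK _ _ 3 8) (@hsubmxK _ _ 3 11).
Qed.

Lemma dotE k (x y : 'rV[K]_k) : (x *m y^T) 0 0 = dot x y.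
Proof. by rewrite mxE; apply: eq_bigr => i _; rewrite mxE. Qed.

Lemma dot_adj k l (x : 'rV[K]_k) (P : 'M_(k, l)) (y : 'rV_l) :
  dot x (y *m P^T) = dot (x *m P) y.
Proof. by rewrite -!dotE trmx_mul trmxK mulmxA. Qed.

Lemma dot_Cmx x y : dot (x *m Cmx) (y *m Cmx) = dot x y.
Proof. by rewrite /dot !sum3E !mulmx_Cmx !mxE !ord3_val /=; ring. Qed.

(** The block [g *: Cmx] meets the factor [- Cmx] of the coordinate change; [Cmx] is an involution,
    which leaves the scalar [- g]. *)
Lemma form32_comb A g x u M y v N :
  form32 A g (comb (gens false) x u M) (comb (gens false) y v N) =
  beta A (- g) 0 x u M y v N.
Proof.
rewrite /form32 /gram_form !coords32 /mx32 (@tr_row_mx _ 1 3 3).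
rewrite (@mul_row_block _ 1 3 3 3 3) (@mul_row_col _ 1 3 3 1) mulmx0 addr0.
rewrite [LHS]mxE !dotE -!scalemxAr mulNmx CmxK dotDl dotNr !dotZl dotNl dot_Cmx.
by rewrite /beta !tau0 bil0 bil_mul; ring.
Qed.

Lemma conj_Cmx S : Cmx *m S *m Cmx =
  mx_of_rows 3 3 [:: [:: S 2 2; - S 2 1; S 2 0]; [:: - S 1 2; S 1 1; - S 1 0];
                     [:: S 0 2; - S 0 1; S 0 0]].
Proof.
have CE i j : Cmx i j =
    nth 0 (nth [::] [:: [:: 0; 0; 1]; [:: 0; -1; 0]; [:: 1; 0; 0]] i) j :> K.
  by rewrite mxE.
apply/matrixP; apply: ord3_ind; apply: ord3_ind; rewrite mxE !sum3E;
  rewrite ![(Cmx *m S) _ _]mxE !sum3E !CE !mxE !ord3_val /=; ring.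
Qed.

(** This recognizes [primemx] as the matrix of the pairing of degree one with degree three. Symmetry
    of [S] enters because [primemx] reads only the upper triangle. *)
Lemma tau_primemx S x N : S^T = S ->
  dot (x *m primemx S) (row8 N) = tau (Cmx *m S *m Cmx) x N.
Proof.
move=> /matrixP St; have S10 := St 0 1; have S20 := St 0 2; have S21 := St 1 2.
rewrite !mxE in S10 S20 S21.
rewrite conj_Cmx S10 S20 S21 /tau !sum3E !crossE.
rewrite /dot sum8E !mxE !sum3E !mxE !ord3_val !ord8_val /=; ring.
Qed.

Lemma form33_comb A g S x u M y v N : S^T = S ->
  form33 A g S (comb (gens true) x u M) (comb (gens true) y v N) =
  beta A (- g) (Cmx *m S *m Cmx) x u M y v N.
Proof.
move=> St.
rewrite /form33 /gram_form !coords33 /mx33.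
rewrite (@mul_row_block _ 1 3 11 3 11) (@tr_row_mx _ 1 3 11) (@mul_row_col _ 1 3 11 1).
rewrite (@tr_row_mx _ 1 3 8) (@mul_row_block _ 1 3 8 3 8) (@mul_row_col _ 1 3 8 3).
rewrite (@mul_mx_row _ 1 3 3 8) (@add_row_mx _ 1 3 8) (@mul_row_col _ 1 3 8 1).
rewrite !mulmx0 !addr0 [LHS]mxE [X in _ + X]mxE !dotE !dotDl -!scalemxAr.
rewrite !mulNmx CmxK !(dotNl, dotNr, dotZl, dotZr) dot_Cmx.
rewrite tau_primemx // [dot (row8 M *m _) y](_ : _ = tau (Cmx *m S *m Cmx) y M).
  rewrite /beta bil_mul [bil (Cmx *m S *m Cmx) u v]bil_mul !mulmxA.
  have -> : dot (u *m Cmx *m S *m Cmx) v = dot (u *m Cmx *m S) (v *m Cmx).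
    by rewrite -{1}(CmxK v) dot_Cmx.
  by ring.
by rewrite -tau_primemx // dotC dot_adj.
Qed.

End MatrixForms.

Lemma ord2_val : ((nat_of_ord (0%R : 'I_2) = 0%N) * (nat_of_ord (1%R : 'I_2) = 1%N))%type.
Proof. by []. Qed.

Lemma det2E (K : fieldType) (A : 'M[K]_2) : \det A = A 0 0 * A 1 1 - A 0 1 * A 1 0.
Proof.
(* Entries are read from natural numbers through [inord], so that ordinals of equal value but
   different form become the same term. *)
pose Q a b := A (inord a) (inord b).
have AE i j : A i j = Q i j by rewrite /Q !inord_val.
rewrite (expand_det_row _ 0) !big_ord_recl big_ord0 /cofactor !det_mx11 !mxE.
rewrite !AE /= /bump /= !addn0; ring.
Qed.
(** * Isometries *)

Section Cofactor.
Variable K : fieldType.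
Implicit Types (P R S : 'M[K]_3).

Lemma cofactor_mx_tr P : cofactor_mx P^T = (cofactor_mx P)^T.
Proof. by apply/matrixP => i j; rewrite !mxE cofactor_tr. Qed.

Lemma cofactor_mxE P i j : cofactor_mx P i j =
  P (i + 1) (j + 1) * P (i + 2) (j + 2) - P (i + 1) (j + 2) * P (i + 2) (j + 1).
Proof.
pose Q a b := P (inord a) (inord b).
have PE k l : P k l = Q k l by rewrite /Q !inord_val.
have lE n (k : 'I_n) l : nat_of_ord (lift k l) = bump k l by [].
rewrite mxE /cofactor det2E !mxE !PE !lE !ord2_val {PE lE}.
move: Q; move: i; apply: ord3_ind; move: j; apply: ord3_ind => Q;
  rewrite !ord3_addE !ord3_val /bump /=; ring.
Qed.

(** An endomorphism with linear part [P] sends [Y_i] to the cross product of two rows of [P], modulo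
    degree three; it thus acts on the [Y_i] through the cofactor matrix. *)
Lemma row_cofactor P i :
  row i (cofactor_mx P) = cross (row (i + 1) P) (row (i + 2) P).
Proof.
apply/rowP => j; rewrite [LHS]mxE cofactor_mxE [RHS]mxE.
by congr (_ * _ - _ * _); rewrite mxE.
Qed.

Lemma mul_cofactor P : P *m (cofactor_mx P)^T = (\det P)%:M.
Proof.
rewrite -mul_mx_adj; congr (_ *m _).
by apply/matrixP => i j; rewrite [LHS]mxE [LHS]mxE [RHS]mxE.
Qed.

Lemma cofactor_mx1 : cofactor_mx 1%:M = 1%:M :> 'M[K]_3.
Proof. by apply: trmx_inj; rewrite -[LHS]mul1mx mul_cofactor det1 trmx1. Qed.

Lemma cross_row1 i : cross (row (i + 1) 1%:M) (row (i + 2) 1%:M) = row i 1%:M :> 'rV[K]_3.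
Proof. by rewrite -row_cofactor cofactor_mx1. Qed.

End Cofactor.

(** Freeness supplies the inverse: sending each generator to a preimage defines [g] with [f \o g]
    the identity, and [g] is then an isometry. In the other order [f] kills [g (f p) - p], so the
    isometry property puts this difference into the kernel of [B1]. *)
Lemma iso_of_isometry (K : fieldType) (d t : nat) (B1 B2 : sym0 K d t)
    (f : free_nilp K d t -> free_nilp K d t) :
  lie_morphism f -> (forall p q, B1 p q = B2 (f p) (f q)) ->
  (forall q, exists p, f p = q) -> isomorphic B1 B2.
Proof.
move=> fP fB fsurj; have [h hX] := choice fsurj.
have [g [gP gX]] := nilp_lift (fun i => h (nilp_gen K t i)) (@free_nilp_lcs0 K d t).
have fg : f \o g =1 id.
  by apply: nilp_morph_eq => [|//|i /=]; [exact: morph_comp | rewrite gX hX].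
have gB p q : B2 p q = B1 (g p) (g q) by rewrite fB -[p in LHS]fg -[q in LHS]fg.
have fm : is_mend B1 B2 f.
  split=> // _ [p kp <-] q; have [r <-] := fsurj q.
  by rewrite -fB; exact: kp.
have gm : is_mend B2 B1 g.
  split=> // _ [p kp <-] q; rewrite fB -[f (g p)]/((f \o g) p) fg; exact: kp.
exists (hom_class (Mend fm)), (hom_class (Mend gm)); split; rewrite hom_compE.
  apply/hom_classP => p q /=; rewrite fB.
  have [F FE] := morph_lin fP; rewrite !FE linearB -!FE.
  by rewrite -[f (g (f p))]/((f \o g) (f p)) fg subrr sym0_0l.
apply/hom_classP => p q /=.
by rewrite -[f (g p)]/((f \o g) p) fg subrr sym0_0l.
Qed.

Lemma isomorphic_sym (K : fieldType) (d t : nat) (B1 B2 : sym0 K d t) :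
  isomorphic B1 B2 -> isomorphic B2 B1.
Proof. by move=> [F [G [GF FG]]]; exists G, F. Qed.

Lemma isomorphicP (K : fieldType) (d t : nat) (B1 B2 : sym0 K d t) :
  isomorphic B1 B2 -> exists f g : free_nilp K d t -> free_nilp K d t,
  [/\ is_mend B1 B2 f, is_mend B2 B1 g & forall p, form_ker B1 (g (f p) - p)].
Proof.
move=> [F [G [GF _]]]; exists (repr F), (repr G); split; try exact: mendP.
exact: (iffLR (hom_classP (mend_comp (repr G) (repr F)) (mend_id B1)) GF).
Qed.

Section Data.
Variables (K : fieldType) (b : bool).
Implicit Types (x y u v w : 'rV[K]_3) (M N A S R T : 'M[K]_3).

Local Notation L := (free_nilp K 3 b.+2).
Local Notation X := (gens b).
Let n3 := @nil3 K b.
Implicit Type B : L -> L -> K.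

Definition has_data B A g S := forall x u M y v N,
  B (comb X x u M) (comb X y v N) = beta A g S x u M y v N.

Lemma has_data_eq B1 B2 A g S : has_data B1 A g S -> has_data B2 A g S -> B1 = B2.
Proof.
move=> h1 h2; apply/funext => p; apply/funext => q.
have [x [u [M ->]]] := comb_surj p; have [y [v [N ->]]] := comb_surj q.
by rewrite h1 h2.
Qed.

Lemma has_data_form B : is_bilinear B -> is_symmetric B -> is_invariant B ->
  has_data B (form11 B X) (form12 B X) (form22 B X).
Proof. by move=> Bl Bs Bi x u M y v N; rewrite form_beta. Qed.

Lemma has_data_axioms B A g S : A^T = A -> S^T = S -> has_data B A g S ->
  [/\ is_bilinear B, is_symmetric B & is_invariant B].
Proof.
move=> At St h.
have Bs : is_symmetric B.
  move=> p q; have [x [u [M ->]]] := comb_surj p; have [y [v [N ->]]] := comb_surj q.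
  by rewrite !h beta_sym.
have Bl q : scalar (B^~ q).
  move=> a p r; have [x [u [M ->]]] := comb_surj p; have [y [v [N ->]]] := comb_surj q.
  have [z [w [O ->]]] := comb_surj r.
  by rewrite comb_linear !h beta_linear.
split=> //; first by split=> // p a q r; rewrite !(Bs p) Bl.
move=> p q r; have [x [u [M ->]]] := comb_surj p; have [y [v [N ->]]] := comb_surj q.
have [z [w [O ->]]] := comb_surj r.
by rewrite !(lbr_comb _ n3) !h (@beta_invariant K A g S x u M y v N).
Qed.

(** Brackets of the given elements yield each [Y_i] modulo degree three, and one more bracket yields
    all of degree three exactly; subtracting from the top degree down then gives the [Y_i] and the
    generators. *)
Lemma comb_span (P : set L) : is_subspace P -> (forall p q, P p -> P q -> P (lbr p q)) ->
  (forall i, exists u M, P (comb X (row i 1%:M) u M)) -> forall p, P p.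
Proof.
move=> sP Pbr PX; have [P0 PP] := sP.
have PD p q : P p -> P q -> P (p + q).
  by move=> Pp; rewrite -[p]scale1r; apply: PP.
have PZ a p : P p -> P (a *: p).
  by move=> Pp; rewrite -[_ *: _]addr0; apply: PP.
have PS (F : 'I_3 -> L) : (forall i, P (F i)) -> P (\sum_i F i).
  by move=> h; apply: big_ind => //.
have P2 i : exists M, P (comb X 0 (row i 1%:M) M).
  have [u [M h1]] := PX (i + 1); have [v [N h2]] := PX (i + 2).
  have := Pbr _ _ h1 h2; rewrite (lbr_comb _ n3) cross_row1 => h.
  by exists (u^T *m row (i + 2) 1%:M - v^T *m row (i + 1) 1%:M).
have P3 N : P (comb3 X N).
  rewrite /comb3; apply: (PS (fun i => _)) => i; apply: (PS (fun j => _)) => j; apply: PZ.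
  have [M h1] := P2 i; have [u [N' h2]] := PX j.
  have := Pbr _ _ h1 h2; rewrite (lbr_comb _ n3) crossC linear0 oppr0.
  by rewrite mulmx0 subr0 comb_r -lbr_comb21 -gen2_comb2 comb1_delta.
have P2' i : P (gen2 X i).
  have [M h] := P2 i; have := PP (-1) _ _ (P3 M) h.
  rewrite scaleN1r -comb_r -scaleN1r comb_linear !scaler0 !add0r scaleN1r addNr.
  by rewrite comb_m -gen2_comb2.
have P1 i : P (X i).
  have [u [M h]] := PX i.
  have h2 : P (comb2 X u) by apply: PS => j; apply: PZ.
  have := PP (-1) _ _ (PD _ _ h2 (P3 M)) h.
  rewrite -comb_r -comb_m combD comb_linear !add0r addr0 scaler0 add0r !scaleN1r !addNr.
  by rewrite comb_l comb1_delta.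
exact: nilp_ind.
Qed.

Lemma endo_surj f R T (M : 'I_3 -> 'M[K]_3) : lie_morphism f ->
  (forall i, f (X i) = comb X (row i R) (row i T) (M i)) -> R \in unitmx ->
  forall q, exists p, f p = q.
Proof.
move=> fP fX Ru; have [fl fb] := fP; have [F FE] := morph_lin fP.
apply: comb_span.
- split; first by exists 0; rewrite FE linear0.
  by move=> a _ _ [p <-] [q <-]; exists (a *: p + q); rewrite fl.
- by move=> _ _ [p <-] [q <-]; exists (lbr p q); rewrite fb.
- move=> i; rewrite -(mulVmx Ru) row_mul.
  (* The preimage combines the generators with the coefficients of row [i] of the inverse of [R]. *)
  exists (row i (invmx R) *m T), (\sum_j (invmx R) i j *: M j), (comb1 X (row i (invmx R))).
  rewrite FE linear_sum /comb !linear_sum /= !mulmx_sum_row !linear_sum.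
  rewrite -!big_split; apply: eq_bigr => j _ /=.
  by rewrite !linearZ -FE fX /= !scalerDr mxE.
Qed.

Section Pullback.
Variables (B : L -> L -> K) (A : 'M[K]_3) (g : K) (S : 'M[K]_3).
Hypotheses (At : A^T = A) (St : S^T = S) (BE : has_data B A g S).
Variables (f : L -> L) (R T : 'M[K]_3) (M : 'I_3 -> 'M[K]_3).
Hypotheses (fP : lie_morphism f)
  (fX : forall i, f (X i) = comb X (row i R) (row i T) (M i)).

Definition pull11 : 'M[K]_3 := \matrix_(i, j)
  beta A g S (row i R) (row i T) (M i) (row j R) (row j T) (M j).
Definition pull12 : K := g * \det R + \tr (T *m S *m (cofactor_mx R)^T).
Definition pull22 : 'M[K]_3 := cofactor_mx R *m S *m (cofactor_mx R)^T.

(** The pulled back form is again symmetric and invariant, so [has_data_form] reduces the claim to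
    its values on the generators and the [Y_i]. *)
Lemma has_data_pullback :
  has_data (fun p q => B (f p) (f q)) pull11 pull12 pull22.
Proof.
have [fl fb] := fP; have [Bl Bs Bi] := has_data_axioms At St BE.
set B' := fun p q => _.
have B'l : is_bilinear B'.
  by split=> q a p r; rewrite /B' fl; case: Bl => h1 h2; rewrite ?h1 ?h2.
have B's : is_symmetric B' by move=> p q; apply: Bs.
have B'i : is_invariant B' by move=> p q r; rewrite /B' !fb Bi.
have fg i : exists N, f (gen2 X i) = comb X 0 (row i (cofactor_mx R)) N.
  by rewrite fb !fX (lbr_comb _ n3) row_cofactor; eexists.
have <- : form11 B' X = pull11.
  by apply/matrixP => i j; rewrite !mxE /B' !fX BE.
have <- : form22 B' X = pull22.
  apply/matrixP => i j; rewrite [LHS]mxE /B' mulmx_trE.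
  have [N ->] := fg i; have [O ->] := fg j.
  by rewrite BE beta_0r dotC linear0 mulr0 add0r -/(tauV S O 0) linear0 addr0.
have <- : form12 B' X = pull12; last exact: has_data_form.
(* The [g] term is the triple product of the rows of [R], that is, the determinant; the [bil] term
   and the two [tau] terms are the three diagonal entries under the trace. *)
rewrite /form12 /B' fb !fX (lbr_comb _ n3) BE beta_0r /pull12.
have -> : \det R = (R *m 1%:M *m (cofactor_mx R)^T) 0 0.
  by rewrite mulmx1 mul_cofactor mxE.
rewrite mulmx_trE [bil 1%:M _ _]bil_mul mulmx1 /mxtrace sum3E !mulmx_trE.
rewrite !row_cofactor !ord3_addE.
rewrite linearB /= !tau_outer [cross (row 0 R) (row 2 R)]crossC linearN /=; ring.
Qed.

End Pullback.
End Data.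

(** * Isomorphisms between forms with given data *)

Section Isomorphism.
Variables (K : fieldType) (b : bool).
Implicit Types (x y u v w : 'rV[K]_3) (M N A S R T : 'M[K]_3).

Local Notation L := (free_nilp K 3 b.+2).
Local Notation X := (gens b).

Lemma isomorphic_data (B1 B2 : sym0 K 3 b.+2) A1 g1 S1 A2 g2 S2 R T
    (M : 'I_3 -> 'M[K]_3) :
  has_data B1 A1 g1 S1 -> A2^T = A2 -> S2^T = S2 -> has_data B2 A2 g2 S2 ->
  R \in unitmx -> pull11 A2 g2 S2 R T M = A1 -> pull12 g2 S2 R T = g1 ->
  pull22 S2 R = S1 -> isomorphic B1 B2.
Proof.
move=> h1 At St h2 Ru e1 e2 e3.
have [f [fP fX]] := endo_exists (fun i => comb X (row i R) (row i T) (M i)).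
have fX' i : f (X i) = comb X (row i R) (row i T) (M i).
  by rewrite -[LHS]/((f \o X) i) fX.
apply: (iso_of_isometry fP); last exact: endo_surj fP fX' Ru.
have := has_data_pullback At St h2 fP fX'; rewrite e1 e2 e3 => h3 p q.
by rewrite (has_data_eq h1 h3).
Qed.

Lemma endo_comb (f : L -> L) R T (M : 'I_3 -> 'M[K]_3) : lie_morphism f ->
  (forall i, f (X i) = comb X (row i R) (row i T) (M i)) ->
  forall x u N, exists v O, f (comb X x u N) = comb X (x *m R) v O.
Proof.
move=> fP fX x u N; have [fl fb] := fP; have [F FE] := morph_lin fP.
have -> : comb X x u N = comb1 X x + comb X 0 u N by rewrite -comb_l combD addr0 !add0r.
have : lcs L 2 (f (comb X 0 u N)) by apply: lcs_morph => //; apply/lcs2_comb; exists u, N.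
move=> /lcs2_comb[v [O fO]]; rewrite FE linearD -!FE fO.
have -> : f (comb1 X x) = comb X (x *m R) (x *m T) (\sum_i x 0 i *: M i).
  rewrite FE /comb !mulmx_sum_row !linear_sum -!big_split; apply: eq_bigr => i _ /=.
  by rewrite !linearZ -FE fX /= !scalerDr.
by rewrite combD addr0; do 2!eexists.
Qed.

(** An isomorphism is represented by isometries [f] and [g] with [g \o f] the identity modulo the
    kernel of [B1]. That kernel lies in the derived algebra, so the linear parts multiply to the
    identity; pulling [B1] back along [g] gives [S2]. *)
Lemma isomorphic_unit (B1 B2 : sym0 K 3 b.+2) A2 g2 S2 A1 g1 S1 :
  A1^T = A1 -> S1^T = S1 -> has_data B1 A1 g1 S1 -> has_data B2 A2 g2 S2 ->
  isomorphic B1 B2 -> exists2 R : 'M[K]_3, R \in unitmx & S2 = pull22 S1 R.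
Proof.
move=> At St h1 h2 /isomorphicP[f [g [[fP _ _] [gP gB _] gf]]].
have gen_comb (h : L -> L) : exists R T (M : 'I_3 -> 'M[K]_3),
    forall i, h (X i) = comb X (row i R) (row i T) (M i).
  have [x hx] := choice (fun i => comb_surj (h (X i))).
  have [u hu] := choice hx; have [M hM] := choice hu.
  exists (\matrix_i x i), (\matrix_i u i), M => i.
  by rewrite hM !rowK.
have [R [T [M gX]]] := gen_comb g; have [R' [T' [M' fX]]] := gen_comb f.
exists R.
  suff /mulmx1_unit[] : R' *m R = 1%:M by [].
  apply/row_matrixP => i.
  have : lcs L 2 (g (f (X i)) - X i) by case: (sym0P B1) => _ _ _ + _; apply; apply: gf.
  rewrite fX.
  have [v [N ->]] := endo_comb gP gX (row i R') (row i T') (M' i).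
  rewrite -[X i]comb1_delta -comb_l -scaleN1r combZ combD.
  move=> /lcs2_comb[w [O]] /comb_inj[+ _ _]; rewrite scaleN1r => /eqP.
  by rewrite subr_eq0 row_mul => /eqP.
have h3 := has_data_pullback At St h1 gP gX.
have E : has_data B2 (pull11 A1 g1 S1 R T M) (pull12 g1 S1 R T) (pull22 S1 R).
  by move=> x u N y v O; rewrite gB h3.
apply/matrixP => i j.
have := h2 0 (row i 1%:M) 0 0 (row j 1%:M) 0; rewrite E !beta_0r.
rewrite ![dot 0 _]dotC !linear0 !mulr0 !add0r !addr0.
by rewrite -!mulmx_trE trmx1 !mulmx1 !mul1mx.
Qed.

End Isomorphism.

(** * Class three with [S] of rank at least two *)

Section Class3.
Variable K : fieldType.
Implicit Types (x y u v w : 'rV[K]_3) (M N A S R T : 'M[K]_3).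
Local Notation L3 := (free_nilp K 3 (nat_of_bool true).+2).
Local Notation X3 := (gens true).

Lemma tau_nondeg S x : (2 <= \rank S)%N -> (forall N, tau S x N = 0) -> x = 0.
Proof.
move=> rS /tau_eq0 h; apply: contraTeq rS => x0; rewrite -leqNgt.
by apply/rank_le1_cross; exists x.
Qed.

Lemma tau_ker3 (B : L3 -> L3 -> K) A g S M : has_data B A g S ->
  form_ker B (comb X3 0 0 M) <-> forall y, tau S y M = 0.
Proof.
move=> BE.
have E y v N : B (comb X3 0 0 M) (comb X3 y v N) = tau S y M.
  rewrite (BE 0 0 M) /beta !bil_mul !mul0mx !(dotC 0) !linear0 -/(tauV S N 0) linear0; ring.
split=> h y; first by rewrite -(E y 0 0) h.
by have [x [u [N ->]]] := comb_surj y; rewrite E.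
Qed.

Lemma is_sym0_class3 (B : L3 -> L3 -> K) A g S : A^T = A -> S^T = S ->
  has_data B A g S -> (2 <= \rank S)%N -> is_sym0 B.
Proof.
move=> At St BE rS; have [Bl Bs Bi] := has_data_axioms At St BE.
split=> // [z|h].
  have [x [u [M ->]]] := comb_surj z => k; apply/lcs2_comb; exists u, M.
  rewrite (tau_nondeg rS (_ : forall N, tau S x N = 0)) // => N.
  have := k (comb X3 0 0 N); rewrite BE beta_0r [dot _ 0]linear0 [bil _ _ 0]linear0.
  by rewrite mulr0 !add0r.
have : (row 0 1%:M : 'rV[K]_3) = 0.
  apply: (tau_nondeg rS) => N.
  suff : form_ker B (comb X3 0 0 N) by move/(tau_ker3 _ BE).
  by apply: h; apply/lcs3_comb; exists N.
by move=> /rowP/(_ 0); rewrite !mxE /= => /eqP; rewrite oner_eq0.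
Qed.

(** For fixed [R] the trace term of [pull12] is a nonzero linear function of [T], and the
    degree-three parts [M] change [pull11] by symmetrized [tau] terms, nondegenerate in the rows of
    [R]. So [T] is fixed first and [M] absorbs its effect. *)
Lemma pull_solve A A' g g' S R :
  [pchar K] =i pred0 -> A^T = A -> A'^T = A' -> S^T = S ->
  (2 <= \rank S)%N -> R \in unitmx ->
  exists T (M : 'I_3 -> 'M[K]_3), pull11 A g S R T M = A' /\ pull12 g S R T = g'.
Proof.
move=> char0 At A't St rS Ru.
have two0 : 2%:R != 0 :> K by rewrite ((pcharf0P K).1 char0).
pose D := S *m (cofactor_mx R)^T.
have cu : (cofactor_mx R)^T \in unitmx.
  rewrite unitmxE; apply: contraTT Ru; rewrite !unitmxE !unitfE !negbK => /eqP d0.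
  have := congr1 determinant (mul_cofactor R).
  rewrite det_mulmx d0 mulr0 det_scalar => /eqP.
  by rewrite eq_sym expf_eq0.
have : D != 0.
  apply: contraTneq rS => D0.
  have cf : row_free (cofactor_mx R)^T by rewrite row_free_unit.
  by rewrite -(mxrankMfree S cf) -/D D0 mxrank0.
move=> /matrix0Pn[i [j Dij]].
(* One entry of [T] suffices, placed so that the trace picks the nonzero [D i j]. *)
pose T := ((g' - g * \det R) / D i j) *: delta_mx j i : 'M[K]_3.
have hT : pull12 g S R T = g'.
  rewrite /pull12 -mulmxA -/D -scalemxAl linearZ /= mxtrace_mulC.
  suff -> : \tr (D *m delta_mx j i) = D i j by rewrite divfK // addrC subrK.
  rewrite /mxtrace (bigD1 i) //= big1 ?addr0 => [|k ki].
    rewrite mxE (bigD1 j) //= [delta_mx _ _ _ _]mxE !eqxx mulr1.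
    rewrite big1 ?addr0 // => l /negPf lj.
    by rewrite [delta_mx _ _ _ _]mxE lj mulr0.
  rewrite mxE big1 // => l _.
  by rewrite [delta_mx _ _ _ _]mxE [k == i](negPf ki) andbF mulr0.
pose P := pull11 A g S R T (fun=> 0).
have Pt : P^T = P by apply/matrixP => k l; rewrite !mxE beta_sym.
(* Each [tau] term supplies half of the defect [A' - P], and an entry of [pull11] contains two of
   them. *)
have /choice[M hM] : forall k, exists N,
    forall l, tau S (row l R) N = (2%:R^-1 *: (A' - P)) k l.
  move=> k; have [|N hN] := @tau_solve K S R (row k (2%:R^-1 *: (A' - P))).
    move=> d /(tau_nondeg rS) d0; rewrite (_ : d = 0) ?linear0 //.
    by rewrite -[d](mulmxK Ru) d0 mul0mx.
  by exists N => l; rewrite hN mxE.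
exists T, M; split=> //; apply/matrixP => k l.
have -> : pull11 A g S R T M k l = P k l + tau S (row k R) (M l) + tau S (row l R) (M k).
  by rewrite !mxE /beta !linear0 !addr0.
have A'C : A' l k = A' k l by rewrite -[in RHS]A't mxE.
have PC : P l k = P k l by rewrite -[in RHS]Pt [RHS]mxE.
have cE (Q1 Q2 : 'M[K]_3) p q :
    (2%:R^-1 *: (Q1 - Q2)) p q = 2%:R^-1 * (Q1 p q - Q2 p q) by rewrite !mxE.
have hh : 2%:R^-1 + 2%:R^-1 = 1 :> K by rewrite -[RHS](mulfV two0) mulr_natl mulr2n.
rewrite !hM !cE A'C PC -addrA -mulrDl hh mul1r.
by rewrite addrC subrK.
Qed.

End Class3.

(** * Class two *)

Section Class2.
Variable K : fieldType.
Implicit Types (A S R T : 'M[K]_3).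
Local Notation L2 := (free_nilp K 3 (nat_of_bool false).+2).
Local Notation X2 := (gens false).

(** In class two invariance turns [B(Y_i, Y_j)] into a pairing with a bracket of degree three, so
    [S = 0] and the derived algebra pairs only through [g]. The two kernel conditions together then
    say that [g] is nonzero. *)
Lemma is_sym0_class2P (B : L2 -> L2 -> K) :
  is_sym0 B <-> exists A g, [/\ A^T = A, g != 0 & has_data B A g 0].
Proof.
have BE A g u M y v N : has_data B A g 0 ->
    B (comb X2 0 u M) (comb X2 y v N) = g * dot u y.
  move=> ->; rewrite /beta !bil_mul !mul0mx mulmx0 !tau0 !(dotC 0) !linear0; ring.
split=> [[Bl Bs Bi Bk Bt]|[A [g [At g0 h]]]].
  have h := has_data_form Bl Bs Bi.
  have S0 : form22 B X2 = 0.
    apply/matrixP => i j; rewrite !mxE [gen2 X2 i]/gen2 Bi lbrC.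
    rewrite -[X2 (i + 2)]comb1_delta gen2_comb2 lbr_comb21 comb3_class2 // oppr0.
    exact: form_0r.
  rewrite S0 in h; exists (form11 B X2), (form12 B X2); split=> //.
    exact: form11_sym.
  apply: contra_not_neq Bt => g0 z /lcs2_comb[u [M ->]] q.
  have [y [v [N ->]]] := comb_surj q.
  by rewrite (BE _ _ _ _ _ _ _ h) g0 mul0r.
have S0 : (0 : 'M[K]_3)^T = 0 by rewrite trmx0.
have [Bl Bs Bi] := has_data_axioms At S0 h.
split=> // [z|h2].
  have [x [u [M ->]]] := comb_surj z => k; apply/lcs2_comb; exists u, M.
  suff -> : x = 0 by [].
  apply: dot_eq0 => y; apply: (mulfI g0); rewrite mulr0 dotC -(BE _ _ y 0 x u M h) Bs.
  exact: k.
have : (row 0 1%:M : 'rV[K]_3) = 0.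
  apply: dot_eq0 => y; apply: (mulfI g0); rewrite mulr0 -(BE _ _ (row 0 1%:M) 0 y 0 0 h).
  by apply: h2; apply/lcs2_comb; do 2!eexists.
by move=> /rowP/(_ 0); rewrite !mxE /= => /eqP; rewrite oner_eq0.
Qed.

Lemma isomorphic_class2 (B1 B2 : sym0 K 3 (nat_of_bool false).+2) A g :
  [pchar K] =i pred0 -> A^T = A -> g != 0 ->
  has_data B1 A (- g) 0 -> has_data B2 0 (- 1) 0 -> isomorphic B1 B2.
Proof.
move=> char0 At g0 h1 h2.
have two0 : 2%:R != 0 :> K by rewrite ((pcharf0P K).1 char0).
(* [R] has determinant [g], which turns the scalar [-1] into [- g]. *)
pose R : 'M[K]_3 := diag_mx (\row_i (if i == 0 then g else 1)).
have dR : \det R = g by rewrite det_diag !big_ord_recl big_ord0 !mxE /= !mulr1.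
have Ru : R \in unitmx by rewrite unitmxE unitfE dR.
(* With this [T] the two mixed terms of [pull11] contribute half of [A] each. *)
pose T := - 2%:R^-1 *: (A *m invmx R^T).
apply: (@isomorphic_data K false B1 B2 A (- g) 0 0 (-1) 0 R T (fun=> 0)) => //.
- by rewrite trmx0.
- by rewrite trmx0.
- have TR : T *m R^T = - 2%:R^-1 *: A by rewrite -scalemxAl mulmxKV // unitmx_tr.
  have dTR i j : dot (row i T) (row j R) = - 2%:R^-1 * A i j.
    have := congr1 (fun Q : 'M[K]_3 => Q i j) TR; rewrite [X in _ = X -> _]mxE => <-.
    by rewrite -[T in RHS]mulmx1 mulmx_trE bil_mul mulmx1.
  apply/matrixP => i j; rewrite mxE /beta !bil0 !tau0 dTR [dot (row i R) _]dotC dTR.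
  have -> : A j i = A i j by rewrite -[in RHS]At mxE.
  by rewrite add0r !addr0; field.
- by rewrite /pull12 dR mulmx0 mul0mx linear0 addr0 mulN1r.
- by rewrite /pull22 mulmx0 mul0mx.
Qed.

End Class2.

(** * Decompositions *)

Section OrthogonalProjection.
Variables (K : fieldType) (L : lieAlgType K) (B : L -> L -> K).
Hypotheses (Blin : is_bilinear B) (Bsym : is_symmetric B).
Variables (n : nat) (e : 'I_n -> L).
Hypothesis e_span : forall w, exists c : 'rV[K]_n, w = \sum_i c 0 i *: e i.
Variable I : set L.
Hypotheses (sI : is_subspace I) (ndI : nondegenerate_on B I).

Let lc (c : 'rV[K]_n) : L := \sum_i c 0 i *: e i.
Let lc_linear : linear lc.
Proof.
move=> a x y; rewrite /lc scaler_sumr -big_split; apply: eq_bigr => i _ /=.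
by rewrite !mxE scalerDl scalerA.
Qed.
HB.instance Definition _ := GRing.isLinear.Build K 'rV[K]_n L _ lc lc_linear.

Let gram : 'M[K]_n := \matrix_(i, j) B (e i) (e j).

Let lcB c d : B (lc c) (lc d) = (c *m gram *m d^T) 0 0.
Proof.
rewrite /lc (form_suml Blin Bsym) [RHS]mxE.
under [RHS]eq_bigr do rewrite mxE mulr_suml.
rewrite [RHS]exchange_big; apply: eq_bigr => i _ /=.
rewrite (form_sumr Blin); apply: eq_bigr => j _.
by rewrite (form_Zl Blin Bsym) (form_Zr Blin) !mxE mulrA mulrAC.
Qed.

Let subspace_mul m (c : 'rV[K]_m) (M : 'M[K]_(m, n)) :
  (forall i, I (lc (row i M))) -> I (lc (c *m M)).
Proof.
move=> IM; have [I0 IP] := sI; rewrite mulmx_sum_row linear_sum /=.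
apply: big_ind => [//|p q Ip Iq|i _]; first by rewrite -[p]scale1r; apply: IP.
by rewrite linearZ /= -[_ *: _]addr0; apply: IP.
Qed.

(** Among the matrices with rows in [I], one of maximal rank spans all coordinate vectors of [I]: a
    vector outside its row space could be adjoined. *)
Let subspace_mx : exists M : 'M[K]_n,
  (forall i, I (lc (row i M))) /\ forall c, I (lc c) -> (c <= M)%MS.
Proof.
pose p r := `[< exists M : 'M[K]_n, (forall i, I (lc (row i M))) /\ \rank M = r >].
have ex : exists r, p r.
  exists 0%N; apply/asboolP; exists 0; rewrite mxrank0; split=> // i.
  by rewrite row0 linear0; case: sI.
have ub r : p r -> (r <= n)%N by move=> /asboolP[M [_ <-]]; apply: rank_leq_row.
case: (ex_maxnP ex ub) => r /asboolP[M [IM rM]] maxr.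
exists M; split=> // c Ic; rewrite -[(c <= M)%MS]negbK; apply/negP => ncM.
have : p (\rank (M + c)%MS).
  apply/asboolP; exists (M + c)%MS; split=> // i.
  have /sub_addsmxP[[u v] /= ->] := row_sub i (M + c)%MS.
  rewrite linearD /=; case: (sI) => _ IP; rewrite -[lc (u *m M)]scale1r; apply: IP.
    exact: subspace_mul.
  by apply: subspace_mul => j; rewrite row_id.
move=> /maxr; rewrite leqNgt -rM rank_ltmx //.
by rewrite /ltmx addsmxSl addsmx_sub submx_refl.
Qed.

(** The projection solves a linear system with the Gram matrix [G] of [I]. A vector in the kernel of
    [G] describes an element of [I] orthogonal to [I], hence zero, which makes the system
    solvable. *)
Lemma orthogonal_projection w : exists2 a, I a & forall y, I y -> B (w - a) y = 0.
Proof.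
have [M [IM subM]] := subspace_mx.
pose G := M *m gram *m M^T.
have [c wc] := e_span w; rewrite -/(lc c) in wc.
have /submxP[d dG] : (c *m gram *m M^T <= G)%MS.
  rewrite submxE; apply/eqP/matrixP => i k; rewrite [RHS]mxE [i]ord1.
  pose d := (col k (cokermx G))^T.
  have Gd : G *m d^T = 0 by rewrite trmxK colE mulmxA mulmx_coker mul0mx.
  have d0 : lc (d *m M) = 0.
    apply: ndI => [|y Iy]; first exact: subspace_mul.
    have [c' yc] := e_span y; rewrite -/(lc c') in yc.
    have /submxP[u cu] : (c' <= M)%MS by apply: subM; rewrite -yc.
    rewrite Bsym yc cu lcB trmx_mul !mulmxA -(mulmxA u) -(mulmxA u) -/G.
    by rewrite -mulmxA Gd mulmx0 mxE.
  have := lcB c (d *m M); rewrite d0 (form_0r Blin) trmx_mul trmxK mulmxA => ->.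
  by rewrite colE !mulmxA -colE [RHS]mxE.
exists (lc (d *m M)); first exact: subspace_mul.
move=> y Iy; have [c' yc] := e_span y; rewrite -/(lc c') in yc.
have /submxP[u cu] : (c' <= M)%MS by apply: subM; rewrite -yc.
rewrite wc -linearB /= yc lcB cu trmx_mul mulmxA !mulmxBl dG /G !mulmxA.
by rewrite subrr mxE.
Qed.

End OrthogonalProjection.

Section Indecomposable.
Variable K : fieldType.
Implicit Types (x y u v w : 'rV[K]_3) (M N A S R T : 'M[K]_3).
Local Notation L3 := (free_nilp K 3 (nat_of_bool true).+2).
Local Notation X3 := (gens true).

(* If [x] and [y] are not parallel, all the cross products lie on the line of
   [cross x y], so the plane spanned by [x] and [y] contains [E] and [F]. *)
Lemma cross_ker_dichotomy S (E F : set 'rV[K]_3) : (2 <= \rank S)%N ->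
  (forall z, exists x y, [/\ E x, F y & z = x + y]) ->
  (forall x y, E x -> F y -> cross x y *m S = 0) ->
  (forall x, E x -> x = 0) \/ (forall y, F y -> y = 0).
Proof.
move=> rS EF crossS; apply: contrapT => /not_orP[/existsNP[x0 /not_implyP[Ex0 /eqP nx0]]].
move=> /existsNP[y0 /not_implyP[Fy0 /eqP ny0]].
case: (pselect (exists x y, [/\ E x, F y & cross x y != 0])) => [[x [y [Ex Fy k0]]]|par].
  have y_neq0 : y != 0 by apply: contraNneq k0 => ->; rewrite linear0.
  have x_neq0 : x != 0 by apply: contraNneq k0 => ->; rewrite cross0l.
  have Ek x' : E x' -> dot (cross x y) x' = 0.
    move=> Ex'; have [a ha] := rank_ge2_ker rS k0 (crossS _ _ Ex Fy) (crossS _ _ Ex' Fy).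
    have : cross y (x' - a *: x) = 0.
      by rewrite crossC [x' - _]addrC -scaleNr cross_linearl ha scaleNr addNr oppr0.
    move=> /(cross_eq0 y_neq0)[c hc].
    rewrite -[x'](subrK (a *: x)) hc dotDr !dotZr dot_cross.
    by rewrite [cross y y]cross_self linear0 dotC dot_crossl !mulr0 addr0.
  have Fk y' : F y' -> dot (cross x y) y' = 0.
    move=> Fy'; have [a ha] := rank_ge2_ker rS k0 (crossS _ _ Ex Fy) (crossS _ _ Ex Fy').
    have : cross x (y' - a *: y) = 0 by rewrite linearB linearZ /= ha subrr.
    move=> /(cross_eq0 x_neq0)[c hc].
    rewrite -[y'](subrK (a *: y)) hc dotDr !dotZr [dot _ y]dot_cross.
    by rewrite [cross y y]cross_self linear0 dotC dot_crossl !mulr0 addr0.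
  case/eqP: k0; apply: dot_eq0 => z; have [x' [y' [Ex' Fy' ->]]] := EF z.
  by rewrite dotDr Ek // Fk // addr0.
(* Otherwise every element of [E] is parallel to every element of [F]; then [x0] is parallel to all
   vectors, which is impossible for a nonzero vector. *)
have par0 x y : E x -> F y -> cross x y = 0.
  by move=> Ex Fy; apply/eqP; apply/negPn/negP => k0; apply: par; exists x, y.
have [a ya] := cross_eq0 nx0 (par0 _ _ Ex0 Fy0).
have all_par z : cross x0 z = 0.
  have [x [y [Ex Fy ->]]] := EF z; rewrite linearD /= (par0 _ _ Ex0 Fy) addr0.
  have := par0 _ _ Ex Fy0; rewrite ya linearZ /= => /eqP.
  rewrite scaler_eq0 => /orP[/eqP a0|/eqP h]; last by rewrite crossC h oppr0.
  by case/eqP: ny0; rewrite ya a0 scale0r.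
case/eqP: nx0; apply/rowP => i; rewrite mxE -dot_row1 -cross_row1.
by rewrite -dot_cross all_par dotC linear0.
Qed.

Variable B : sym0 K 3 (nat_of_bool true).+2.
Variables (A : 'M[K]_3) (g : K) (S : 'M[K]_3).
Hypothesis BE : has_data B A g S.

(** Elements of the derived algebra commute, so brackets of [e] with [E] vanish and those with [F]
    lie in the kernel. By invariance [e] is orthogonal to the derived algebra, hence to [E], and it
    is orthogonal to [F] by assumption. *)
Lemma lcs2_split_ker (E F : set L3) :
  (forall z, exists e f, [/\ E e, F f & z = e + f]) ->
  (forall e f, E e -> F f -> form_ker B (lbr e f)) ->
  (forall e f, E e -> F f -> B e f = 0) ->
  (forall e, E e -> lcs L3 2 e) -> forall e, E e -> form_ker B e.
Proof.
move=> EF brEF BEF E2 e Ee.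
have kbr n : form_ker B (lbr e n).
  have [e' [f [Ee' Ff ->]]] := EF n; rewrite lbrDr.
  have -> : lbr e e' = 0; last by rewrite add0r; apply: brEF.
  have /lcs2_comb[u [M ->]] := E2 _ Ee; have /lcs2_comb[v [N ->]] := E2 _ Ee'.
  by rewrite (lbr_comb _ (@nil3 K true)) !mulmx0 subrr linear0 comb0.
have e2 n : lcs L3 2 n -> B e n = 0.
  apply: (@lcs_sub _ _ 0 (fun n => B e n = 0)).
    split=> [|a p q hp hq]; first by rewrite sym0_sym sym0_0l.
    by rewrite sym0_Pr hp hq mulr0 addr0.
  by move=> p q _; rewrite -sym0_inv; apply: kbr.
move=> n; have [e' [f [Ee' Ff ->]]] := EF n.
by rewrite sym0_sym sym0_Dl !(sym0_sym B _ e) e2 ?BEF ?addr0 //; apply: E2.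
Qed.

(** A bracket in the kernel is orthogonal to every [Y_i], so [S] annihilates the cross product of
    the linear parts of [e] and [f]. The dichotomy then puts [E] or [F] into the derived algebra. *)
Lemma sum_split_ker (E F : set L3) : (2 <= \rank S)%N ->
  (forall z, exists e f, [/\ E e, F f & z = e + f]) ->
  (forall e f, E e -> F f -> form_ker B (lbr e f)) ->
  (forall e f, E e -> F f -> B e f = 0) ->
  (forall e, E e -> form_ker B e) \/ (forall f, F f -> form_ker B f).
Proof.
move=> rS EF brEF BEF.
pose low (G : set L3) : set 'rV[K]_3 := fun x => exists u M, G (comb X3 x u M).
have low0 G : (forall x, low G x -> x = 0) -> forall z, G z -> lcs L3 2 z.
  move=> G0 z; have [x [u [M ->]]] := comb_surj z => Gz; apply/lcs2_comb; exists u, M.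
  by rewrite (G0 x) //; exists u, M.
have [||E0|F0] := @cross_ker_dichotomy S (low E) (low F) rS.
- move=> z; have [e [f [Ee Ff zE]]] := EF (comb X3 z 0 0).
  have [x [u [M eE]]] := comb_surj e; have [y [v [N fE]]] := comb_surj f.
  exists x, y; split; [by exists u, M; rewrite -eE | by exists v, N; rewrite -fE |].
  by move: zE; rewrite eE fE combD => /comb_inj[].
- move=> x y [u [M Ee]] [v [N Ff]]; have := brEF _ _ Ee Ff.
  rewrite (lbr_comb _ (@nil3 K true)) => k; apply: dot_eq0 => w.
  have := k (comb X3 0 w 0); rewrite BE beta_0r !linear0 !addr0.
  by rewrite dotC linear0 mulr0 add0r bil_mul.
- by left; apply: (lcs2_split_ker EF brEF BEF); apply: low0.
- right; apply: (@lcs2_split_ker F E); last exact: low0.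
  + by move=> z; have [e [f [Ee Ff ->]]] := EF z; exists f, e; rewrite addrC.
  + move=> f e Ff Ee; rewrite lbrC; apply: (lie_idealN (I := form_ker_ideal B)).
    exact: brEF.
  + by move=> f e Ff Ee; rewrite sym0_sym BEF.
Qed.

End Indecomposable.

(** * Decomposability of the quotient and the rank of [S] *)

Section Quotient.
Variable K : fieldType.
Implicit Types (x y u v w : 'rV[K]_3) (M N A S R T : 'M[K]_3).
Local Notation L3 := (free_nilp K 3 (nat_of_bool true).+2).
Local Notation X3 := (gens true).
Variable B : sym0 K 3 (nat_of_bool true).+2.
Variables (A : 'M[K]_3) (g : K) (S : 'M[K]_3).
Hypothesis BE : has_data B A g S.

Local Notation Q := (form_quot B).
Local Notation proj := (lie_proj (form_ker_ideal B)).

Lemma proj_eq0 z : proj z = 0 <-> form_ker B z.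
Proof. by rewrite -lie_proj0 lie_projP subr0. Qed.

Lemma indecomposable_rank : (2 <= \rank S)%N -> indecomposable (sym0_quad B).
Proof.
move=> rS [I [[sI Ibr] In0 InT ndI]].
have [I0 IP] := sI.
have Ql := form_quot_bilinear B; have Qs := @form_quot_symmetric _ _ _ B.
have span (w : Q) : exists c : 'rV[K]_14, w = \sum_i c 0 i *: proj (tnth (basis33 K) i).
  have [x [u [M zE]]] := comb_surj (repr w : L3).
  exists (row_mx x (row_mx (- (u *m Cmx)) (row8 M)) : 'rV_(3 + (3 + 8))).
  have [F FE] := morph_lin (lie_proj_morphism (form_ker_ideal B)).
  rewrite -[LHS]lie_reprK zE comb_basis33 FE linear_sum.
  by apply: eq_bigr => i _; rewrite linearZ -FE.
have orth := @orthogonal_projection K Q (@form_quot_form _ _ _ B) Ql Qs 14 _ span I sI ndI.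
pose J : set Q := fun q => forall r : Q, I r -> form_quot_form q r = 0.
(* Invariance moves the bracket with [i] onto an element of the ideal, which is orthogonal to [j];
   nondegeneracy of the quotient form concludes. *)
have brIJ i j : I i -> J j -> lbr i j = 0.
  move=> Ii Jj; have : form_ker (@form_quot_form _ _ _ B) (lbr i j).
    move=> w; rewrite form_quot_invariant Qs form_quot_invariant.
    by apply: Jj; rewrite lbrC; apply: (@lie_idealN _ _ (LieIdeal (conj sI Ibr))); apply: Ibr.
  by rewrite form_quot_nondeg.
(* These are the preimages of [I] and of its orthogonal; if one of them lies in the kernel, [I] is
   zero or everything. *)
pose E : set L3 := fun z => I (proj z); pose F : set L3 := fun z => J (proj z).
have [pl pb] := lie_proj_morphism (form_ker_ideal B).
have [|||kE|kF] := @sum_split_ker K B A g S BE E F rS.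
- move=> z; have [a Ia Ja] := orth (proj z).
  exists (repr a), (z - repr a); split; last by rewrite [RHS]addrC subrK.
    by rewrite /E lie_reprK.
  by rewrite /F -scaleN1r addrC pl lie_reprK scaleN1r addrC.
- by move=> e f Ee Ff; apply/proj_eq0; rewrite pb; apply: brIJ.
- by move=> e f Ee Ff; rewrite -form_quot_formE Qs; apply: Ff.
- case: In0; apply/seteqP; split=> [q Iq|_ ->]; last exact: I0.
  by rewrite -[q]lie_reprK; apply/proj_eq0/kE; rewrite /E lie_reprK.
- case: InT; apply/seteqP; split=> // q _.
  have [a Ia Ja] := orth q.
  suff : q - a = 0 by move=> /subr0_eq->.
  by rewrite -[q - a]lie_reprK; apply/proj_eq0/kF; rewrite /F lie_reprK.
Qed.

(** The rows of [S] have a common direction [x], so [tau S x] vanishes. Adding a suitable part of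
    degree two gives [z] orthogonal to the derived algebra, and [z] spans an orthogonal summand. *)
Lemma decomposable_rank : (\rank S <= 1)%N -> decomposable (sym0_quad B).
Proof.
move=> /rank_le1_cross[x nx0 Sx].
have [Bl Bs Bi Bk Bt] := sym0P B.
have /choice[c cS] : forall i, exists a, row i S = a *: x.
  by move=> i; apply: cross_eq0.
(* If [S] were zero, the third term of the lower central series would lie in the kernel. *)
have [i ci] : exists i, c i != 0.
  apply: contrapT => c0; apply: Bt => _ /lcs3_comb[M ->].
  apply/(tau_ker3 _ BE) => y; suff -> : S = 0 by rewrite tau0.
  apply/row_matrixP => i; rewrite row0 cS; have [->|ni] := eqVneq (c i) 0.
    by rewrite scale0r.
  by case: c0; exists i.
(* With this [u] the term [bil S u v] cancels [g * dot x v], so [z] pairs only with linear parts. *)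
pose u : 'rV[K]_3 := - (g / c i) *: row i 1%:M.
have uS : u *m S = - g *: x.
  by rewrite -scalemxAl -row_mul mul1mx cS scalerA mulNr divfK.
pose z := comb X3 x u 0.
have tau_x N : tau S x N = 0 by move: N; apply/tau_eq0.
have zE y v N : B z (comb X3 y v N) = B z (comb1 X3 y).
  rewrite -(comb_l X3 y) !BE /beta !tau_x [bil S u v]bil_mul uS.
  by rewrite [dot (- g *: x) v]dotZl !linear0; ring.
(* If [B z z = 0], a correction of degree three moves [z] into the kernel, although its linear part
   is nonzero. The system is solvable because its relations are the multiples of [x], and [z] is
   orthogonal to [x]. *)
have [zz0|zz] := eqVneq (B z z) 0.
  have zx : B z (comb1 X3 x) = 0 by rewrite -(zE _ u 0).
  have [|N hN] := @tau_solve K S 1%:M (- \row_j B z (X3 j)).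
    move=> d; rewrite mulmx1 => /tau_eq0 Sd.
    have : cross x d = 0.
      have := Sd i; rewrite cS linearZ /= => /eqP; rewrite scaler_eq0 (negPf ci) /=.
      by rewrite crossC oppr_eq0 => /eqP.
    move=> /(cross_eq0 nx0)[a ->]; rewrite linearZ /= dotNl.
    have -> : dot (\row_j B z (X3 j)) x = B z (comb1 X3 x).
      by rewrite (form_sumr Bl); apply: eq_bigr => j _; rewrite (form_Zr Bl) mxE mulrC.
    by rewrite zx oppr0 mulr0.
  have : form_ker B (comb X3 x u N).
    move=> q; have [y [v [O ->]]] := comb_surj q.
    have -> : comb X3 x u N = comb X3 0 0 N + z by rewrite /z combD !add0r addr0.
    rewrite sym0_Dl zE.
    have -> : B (comb X3 0 0 N) (comb X3 y v O) = tau S y N.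
      rewrite sym0_sym BE beta_0r [dot _ 0]linear0 [bil _ _ 0]linear0; ring.
    rewrite /comb1 (form_sumr Bl) -[tau S y N]/(tauV S N y).
    have {1}-> : y = \sum_j y 0 j *: row j 1%:M by rewrite -mulmx_sum_row mulmx1.
    rewrite linear_sum -big_split big1 // => j _ /=.
    by rewrite linearZ /= [tauV _ _ _]hN !mxE (form_Zr Bl); ring.
  move=> /Bk/lcs2_comb[v [M]] /comb_inj[x0 _ _].
  by rewrite x0 eqxx in nx0.
(* Otherwise the line of [z] is an ideal, being central in the quotient, and the form is
   nondegenerate on it. *)
pose I : set Q := fun q => exists a, q = a *: proj z.
have [pl pb] := lie_proj_morphism (form_ker_ideal B).
have zbr (q : Q) : lbr (proj z) q = 0.
  rewrite -[q]lie_reprK -pb; apply/proj_eq0 => r; rewrite Bi.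
  have [x1 [u1 [M1 ->]]] := comb_surj (repr q : L3).
  have [x2 [u2 [M2 ->]]] := comb_surj r.
  rewrite (lbr_comb _ (@nil3 K true)) zE linear0; exact: (form_0r Bl).
have pz a : a *: proj z = proj (a *: z).
  by rewrite -[a *: z]addr0 pl lie_proj0 addr0.
exists I; split.
- split; last by move=> _ q [a ->]; exists 0; rewrite lbrZl zbr scaler0 scale0r.
  split; first by exists 0; rewrite scale0r.
  by move=> a _ _ [c1 ->] [c2 ->]; exists (a * c1 + c2); rewrite scalerA scalerDl.
- move=> I0; have : I (proj z) by exists 1; rewrite scale1r.
  rewrite I0 => /proj_eq0 k; by rewrite k eqxx in zz.
(* If the line were everything, elements of degree three would be multiples of [z] modulo the
   kernel; as they are orthogonal to [z], they would lie in the kernel. *)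
- move=> IT; apply: Bt => _ /lcs3_comb[M ->].
  have : I (proj (comb X3 0 0 M)) by rewrite IT.
  move=> [a]; rewrite pz => /lie_projP k.
  have zM : B z (comb X3 0 0 M) = 0 by rewrite zE linear0; exact: (form_0r Bl).
  have := k z; rewrite /= -scaleNr addrC sym0_Pl (sym0_sym B (comb X3 0 0 M)) zM.
  rewrite addr0 => /eqP; rewrite mulf_eq0 (negPf zz) orbF oppr_eq0 => /eqP a0.
  by move: k; rewrite a0 scale0r subr0.
- move=> _ [a ->] h.
  have : form_quot_form (proj (a *: z)) (proj z) = 0.
    by rewrite -pz; apply: h; exists 1; rewrite scale1r.
  rewrite form_quot_formE (form_Zl Bl Bs) => /eqP.
  by rewrite mulf_eq0 (negPf zz) orbF => /eqP ->; rewrite scale0r.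
Qed.

End Quotient.

(** * Conjugation by [Cmx] and the given forms *)

Section Conjugation.
Variable K : fieldType.
Implicit Types S A : 'M[K]_3.

Lemma conj_CmxK S : Cmx *m (Cmx *m S *m Cmx) *m Cmx = S.
Proof. by rewrite !mulmxA Cmx_sqr mul1mx -mulmxA Cmx_sqr mulmx1. Qed.

Lemma conj_Cmx_sym S : S^T = S -> (Cmx *m S *m Cmx)^T = Cmx *m S *m Cmx.
Proof. by move=> St; rewrite !trmx_mul St trmx_Cmx mulmxA. Qed.

Lemma rank_conj_Cmx S : \rank (Cmx *m S *m Cmx) = \rank S.
Proof.
have Cu : (Cmx : 'M[K]_3) \in unitmx by case/mulmx1_unit: (Cmx_sqr K).
by rewrite mxrankMfree ?row_free_unit // (eqmxMfull _ _) // row_full_unit.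
Qed.

Lemma has_data_form33 A g S : S^T = S ->
  has_data (b := true) (form33 A g S) A (- g) (Cmx *m S *m Cmx).
Proof. by move=> St x u M y v N; apply: form33_comb. Qed.

Lemma has_data_form32 A g : has_data (b := false) (form32 A g) A (- g) 0.
Proof. by move=> x u M y v N; apply: form32_comb. Qed.

Lemma is_sym0_form33 A g S : A^T = A -> S^T = S -> (2 <= \rank S)%N ->
  is_sym0 (form33 A g S).
Proof.
move=> At St rS.
apply: (is_sym0_class3 At (conj_Cmx_sym St) (has_data_form33 A g St)).
by rewrite rank_conj_Cmx.
Qed.

Lemma is_sym0_form32 A g : A^T = A -> g != 0 -> is_sym0 (form32 A g).
Proof.
move=> At g0; apply/(@is_sym0_class2P K); exists A, (- g); rewrite oppr_eq0.
by split=> //; apply: has_data_form32.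
Qed.

End Conjugation.

(** * The classification in classes two and three *)

Theorem theorem5p5 (K : fieldType) (charK : [pchar K] =i pred0) :
  ((forall B : free_nilp K 3 2 -> free_nilp K 3 2 -> K,
      is_sym0 B <->
      exists (A : 'M[K]_3) (gam : K),
        [/\ A^T = A, gam != 0 & B = form32 A gam])
   /\
   (forall (A : 'M[K]_3) (gam : K), A^T = A -> gam != 0 ->
      exists (hB : is_sym0 (form32 A gam)) (h0 : is_sym0 (form32 (0 : 'M[K]_3) 1)),
        isomorphic (Sym0 hB) (Sym0 h0)))
  /\
  ((forall B : free_nilp K 3 3 -> free_nilp K 3 3 -> K,
      (exists hB : is_sym0 B, indecomposable (sym0_quad (Sym0 hB))) <->
      exists (A1 : 'M[K]_3) (gam : K) (A2 : 'M[K]_3),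
        [/\ A1^T = A1, A2^T = A2, (2 <= \rank A2)%N & B = form33 A1 gam A2])
   /\
   (forall (A1 B1 : 'M[K]_3) (del gam : K) (A2 B2 : 'M[K]_3),
      A1^T = A1 -> B1^T = B1 -> A2^T = A2 -> B2^T = B2 ->
      (2 <= \rank A2)%N -> (2 <= \rank B2)%N ->
      exists (hA : is_sym0 (form33 A1 del A2)) (hB : is_sym0 (form33 B1 gam B2)),
        (isomorphic (Sym0 hA) (Sym0 hB) <->
         exists P : 'M[K]_3,
           P \in unitmx /\
           Cmx *m B2 *m Cmx =
             (cofactor_mx P)^T *m Cmx *m A2 *m Cmx *m cofactor_mx P))).
Proof.
split; split.
- move=> B; split=> [/(@is_sym0_class2P K)[A [g [At g0 h]]]|[A [g [At g0 ->]]]].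
    exists A, (- g); split=> //; first by rewrite oppr_eq0.
    by apply: (has_data_eq h); rewrite -{2}[g]opprK; apply: has_data_form32.
  exact: is_sym0_form32.
- move=> A g At g0.
  have t0 : (0 : 'M[K]_3)^T = 0 by rewrite trmx0.
  exists (is_sym0_form32 At g0), (is_sym0_form32 t0 (oner_neq0 K)).
  apply: (@isomorphic_class2 K _ _ A g charK At g0); exact: has_data_form32.
- move=> B; split=> [[hB ind]|[A [g [S [At St rS ->]]]]]; last first.
    exists (is_sym0_form33 g At St rS).
    apply: (@indecomposable_rank K (Sym0 (is_sym0_form33 g At St rS)) _ _ _
      (has_data_form33 A g St)).
    by rewrite rank_conj_Cmx.
  have [Bl Bs Bi _ _] := hB; have h := @has_data_form K true B Bl Bs Bi.
  have St := form22_sym Bs (gens true).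
  exists (form11 B (gens true)), (- form12 B (gens true)),
    (Cmx *m form22 B (gens true) *m Cmx); split.
  + exact: form11_sym.
  + exact: conj_Cmx_sym.
  + rewrite rank_conj_Cmx ltnNge; apply/negP => r1; apply: ind.
    exact: (@decomposable_rank K (Sym0 hB) _ _ _ h).
  + apply: (has_data_eq h).
    have := has_data_form33 (form11 B (gens true)) (- form12 B (gens true)) (conj_Cmx_sym St).
    by rewrite opprK conj_CmxK.
- move=> A1 B1 del gam A2 B2 A1t B1t A2t B2t rA rB.
  pose hBA := is_sym0_form33 del A1t A2t rA.
  pose hBB := is_sym0_form33 gam B1t B2t rB.
  exists hBA, hBB; have hA := has_data_form33 A1 del A2t.
  have hB := has_data_form33 B1 gam B2t; have SAt := conj_Cmx_sym A2t.
  split=> [iso|[P [Pu PE]]].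
    have [R Ru SR] :=
      @isomorphic_unit K true (Sym0 hBA) (Sym0 hBB) _ _ _ _ _ _ A1t SAt hA hB iso.
    (* [pull22] has the cofactor matrix on the left and its transpose on the right, the statement
       has the reverse, so [P] is the transpose of [R]. *)
    exists R^T; rewrite unitmx_tr cofactor_mx_tr trmxK SR /pull22.
    by rewrite !mulmxA.
  have Ru : P^T \in unitmx by rewrite unitmx_tr.
  have rSA : (2 <= \rank (Cmx *m A2 *m Cmx))%N by rewrite rank_conj_Cmx.
  have [T [M [e1 e2]]] := pull_solve (- del) (- gam) charK A1t B1t SAt rSA Ru.
  (* The form built from [A2] pulls back to the one built from [B2], which yields the isomorphism in
     the reverse direction. *)
  apply: isomorphic_sym.
  apply: (@isomorphic_data K true (Sym0 hBB) (Sym0 hBA) _ _ _ _ _ _ _ T M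
    hB A1t SAt hA Ru e1 e2).
  by rewrite PE /pull22 cofactor_mx_tr trmxK !mulmxA.
Qed.
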